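(* $P_5$ has the polynomial R\''odl property; that is, there exists $d>0$ such that for every $\varepsilon\in(0,1/2)$, every $P_5$-free graph $G$ has an $\varepsilon$-restricted induced subgraph with at least $\varepsilon^d|G|$ vertices.
   Context: All graphs are finite and simple. $P_5$ is the five-vertex path. A graph $G$ is $H$-free if it has no induced subgraph isomorphic to $H$. $|G|$ denotes the number of vertices of $G$ and $\overline G$ its complement. For $\varepsilon>0$, $G$ is $\varepsilon$-sparse if its maximum degree is at most $\varepsilon|G|$, and $\varepsilon$-restricted if one of $G,\overline G$ is $\varepsilon$-sparse. A graph $H$ has the polynomial R\''odl property if there exists $d>0$ such that for every $\varepsilon\in(0,1/2)$, every $H$-free graph $G$ has an $\varepsilon$-restricted induced subgraph with at least $\varepsilon^d|G|$ vertices. *)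

(* Defs.v *)
From mathcomp Require Import all_boot.
From Stdlib Require Import Reals.
Set Implicit Arguments. Unset Strict Implicit. Unset Printing Implicit Defensive.

Definition simple_graph (T : finType) (e : rel T) : Prop :=
  symmetric e /\ irreflexive e.

Definition compl_rel (T : finType) (e : rel T) : rel T :=
  fun x y => (x != y) && ~~ e x y.

Definition has_induced_P5 (T : finType) (e : rel T) : Prop :=
  exists f : 'I_5 -> T, injective f /\
    forall i j : 'I_5, e (f i) (f j) = ((i.+1 == j :> nat) || (j.+1 == i :> nat)).

Definition P5_free (T : finType) (e : rel T) : Prop := ~ has_induced_P5 e.

Definition sparse_on (T : finType) (e : rel T) (S : {set T}) (eps : R) : Prop :=
  forall v, v \in S -> (INR #|[set u in S | e v u]| <= eps * INR #|S|)%R.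

Definition restricted_on (T : finType) (e : rel T) (S : {set T}) (eps : R) : Prop :=
  sparse_on e S eps \/ sparse_on (compl_rel e) S eps.

(* Main.v *)
(** Write [e] for the graph and [h] for its complement.  Linear-size restricted sets for constant
    density come from greedily embedding a path: a failure gives a sparse pair of linear-size
    sets, and combining such pairs recursively yields many pairwise sparse sets in one of the two
    graphs.

    Density [1/Y] is then improved to [1/Y^2], at a cost polynomial in [Y], unless there is a pure
    blockade, i.e. polynomially many pairwise complete (or pairwise anticomplete) sets of
    polynomial size.  In an [e]-sparse graph a Gyarfas path gives a blockade.  In an [h]-sparse
    graph without blockade, pick a vertex [v] of large [h]-degree (a hub) and inside its
    [h]-neighbourhood a set [A] minimising a power of its outer neighbourhood divided by its size.
    Every not too small [B] inside [A] is then mixed to a fair share of the outer vertices [M],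
    and large [e]-components exist.  Two sets that are connected in one graph and separated in
    that graph from each other cannot both be mixed to the same vertex of [M], since this would
    give a house, the complement of the five-vertex path.  Hence producing many such sets
    contradicts double counting, and the density of [A] can be squared repeatedly.

    Finally, blockades are combined as in a cotree: this gives [a] pairwise anticomplete and [b]
    pairwise complete sets with [a * b] as large as wanted, and a union of such sets is
    restricted. *)
Require Import Defs.
From mathcomp Require Import all_boot.
From Stdlib Require Import Reals Lra Classical.
From mathcomp Require Import ssrnat zify.
Set Implicit Arguments. Unset Strict Implicit. Unset Printing Implicit Defensive.

(** * Neighbourhoods, components and greedy selection *)

Section Sets.
Variable T : finType.
Implicit Types (r : rel T) (A B X L P : {set T}).

Definition nb r x X := [set y in X | r x y].

(* Natural numbers stand for inverse densities: maximum degree at most [#|X| / q]. *)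
Definition sp r q X := forall x, x \in X -> q * #|nb r x X| <= #|X|.

(* Includes disjointness of [A] and [B]. *)
Definition anti r A B := forall a b, a \in A -> b \in B -> a != b /\ ~~ r a b.

Definition conn r L := L != set0 /\
  forall P, P \subset L -> P != set0 -> P != L ->
  exists x y, [/\ x \in P, y \in L, y \notin P & r x y].

Lemma sp_set0 r q : sp r q set0.
Proof. by move=> x; rewrite inE. Qed.

Lemma sp_set1 r q x : irreflexive r -> sp r q [set x].
Proof.
move=> ri y /set1P->; rewrite (_ : nb r x [set x] = set0) ?cards0 ?muln0 //.
by apply/setP=> z; rewrite !inE; case: eqP => // ->; rewrite ri.
Qed.

Lemma sp_weak r q q' X : q' <= q -> sp r q X -> sp r q' X.
Proof.
by move=> le H x xX; apply: leq_trans (H x xX); rewrite leq_mul2r le orbT.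
Qed.

Lemma anti_sub r A B A' B' :
  A' \subset A -> B' \subset B -> anti r A B -> anti r A' B'.
Proof. by move=> /subsetP sA /subsetP sB h a b /sA Ha /sB; apply: h. Qed.

Lemma anti_sym r A B : symmetric r -> anti r A B -> anti r B A.
Proof. by move=> rs h a b Ha Hb; rewrite eq_sym rs; apply: h. Qed.

Lemma nb_sub r x X : nb r x X \subset X.
Proof. by apply/subsetP=> y; rewrite inE => /andP[]. Qed.

Lemma nb_mono r x X X' : X \subset X' -> nb r x X \subset nb r x X'.
Proof. by move=> /subsetP s; apply/subsetP=> y; rewrite !inE => /andP[/s -> ->]. Qed.

Lemma trim X n : n <= #|X| -> exists2 X' : {set T}, X' \subset X & #|X'| = n.
Proof.
move=> le; exists [set x in take n (enum X)].
  by apply/subsetP=> x; rewrite inE => /mem_take; rewrite mem_enum.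
have u : uniq (take n (enum X)) by rewrite take_uniq ?enum_uniq.
by rewrite cardsE; move/card_uniqP: u => ->; rewrite size_takel // -cardE.
Qed.

Definition cmp r X x := [set y in X | connect [rel a b | [&& a \in X, b \in X & r a b]] x y].

Section Cmp.
Variables (r : rel T) (X : {set T}).
Hypothesis rs : symmetric r.

Lemma restr_sym : connect_sym [rel a b | [&& a \in X, b \in X & r a b]].
Proof. by apply: sym_connect_sym => a b /=; rewrite rs andbCA. Qed.

Lemma cmp_self x : x \in X -> x \in cmp r X x.
Proof. by move=> Hx; rewrite inE Hx connect0. Qed.

Lemma cmp_sub x : cmp r X x \subset X.
Proof. by apply/subsetP=> y; rewrite inE => /andP[]. Qed.

Lemma cmp_closed x d y : d \in cmp r X x -> y \in X -> r d y -> y \in cmp r X x.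
Proof.
rewrite !inE => /andP[Hd c] Hy rdy; rewrite Hy /=.
by apply: connect_trans c (connect1 _); rewrite /= Hd Hy.
Qed.

Lemma cmp_anti x : anti r (cmp r X x) (X :\: cmp r X x).
Proof.
move=> a b Ha; rewrite inE => /andP[nb Hb]; split; first by apply: contraNneq nb => <-.
by apply: contra nb; apply: cmp_closed.
Qed.

Lemma cmp_eq x y : y \in cmp r X x -> cmp r X y = cmp r X x.
Proof.
rewrite inE => /andP[_ c]; apply/setP=> z; rewrite !inE.
by rewrite (same_connect restr_sym c).
Qed.

Lemma cmp_conn x : x \in X -> conn r (cmp r X x).
Proof.
move=> Hx; split; first by apply/set0Pn; exists x; apply: cmp_self.
move=> P sP /set0Pn[p Hp] neP.
case: (boolP [exists a in P, exists b in cmp r X x, (b \notin P) && r a b]).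
  by case/exists_inP=> a Ha /exists_inP[b Hb /andP[nb rab]]; exists a, b.
rewrite negb_exists_in => /forall_inP no; case/eqP: neP; apply/eqP.
rewrite eqEsubset sP; apply/subsetP=> y Hy.
have Hpx := subsetP sP _ Hp.
have cl : fingraph.closed [rel a b | [&& a \in X, b \in X & r a b]] (mem P).
  apply: intro_closed; first exact: restr_sym.
  move=> a b /= /and3P[Ha Hb rab] aP; move: (no a aP).
  rewrite negb_exists_in => /forall_inP/(_ b).
  rewrite rab andbT negbK; apply; apply: cmp_closed rab => //.
  exact: (subsetP sP).
have : y \in cmp r X p by rewrite (cmp_eq Hpx).
by rewrite inE => /andP[_ /(closed_connect cl) <-].
Qed.

Lemma conn_sub_cmp L x : L \subset X -> conn r L -> x \in L -> L \subset cmp r X x.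
Proof.
move=> sL [_ cL] Hx; have [|ne] := eqVneq (L :&: cmp r X x) L; first by move/setIidPl.
have [||a [b [Ha Hb nb rab]]] := cL (L :&: cmp r X x) _ _ ne; first exact: subsetIl.
  by apply/set0Pn; exists x; rewrite inE Hx cmp_self // (subsetP sL).
move: nb; rewrite inE Hb /= => /negP[]; move: Ha; rewrite inE => /andP[_ Ha].
exact: cmp_closed Ha (subsetP sL _ Hb) rab.
Qed.

End Cmp.

Lemma nb_cmp r X x : symmetric r -> x \in X -> nb r x X \subset cmp r X x.
Proof.
move=> rs Hx; apply/subsetP=> y; rewrite inE => /andP[Hy rxy].
by apply: cmp_closed (cmp_self _ Hx) Hy rxy.
Qed.

Lemma greedy (good : {set T} -> Prop) (R : {set T} -> T -> bool) X (c : nat) :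
  (forall Z : {set T}, Z \subset X -> #|X| <= 2 * #|Z| ->
    exists J : {set T}, [/\ J \subset Z, good J & #|Z| <= #|[set x in Z | R J x]| + c]) ->
  forall k, 2 * (k * c) <= #|X| ->
  exists F : nat -> {set T}, (forall i, i < k -> F i \subset X /\ good (F i)) /\
    (forall i j x, i < j -> j < k -> x \in F j -> R (F i) x).
Proof.
move=> H k le.
suff W k' (Z : {set T}) : Z \subset X -> #|X| + 2 * (k' * c) <= 2 * #|Z| ->
  exists F : nat -> {set T}, (forall i, i < k' -> F i \subset Z /\ good (F i)) /\
    (forall i j x, i < j -> j < k' -> x \in F j -> R (F i) x).
  by apply: W => //; lia.
elim: k' Z => [|k' IH] Z sZ cZ; first by exists (fun=> set0).
have [|J [sJ gJ cJ]] := H Z sZ; first lia.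
have [||F [F1 F2]] := IH [set x in Z | R J x]; try lia.
  by apply: subset_trans sZ; apply/subsetP=> x; rewrite inE => /andP[].
exists (fun i => if i is i'.+1 then F i' else J); split.
  case=> [|i] lti //; have [s g] := F1 i lti; split=> //.
  by apply: subset_trans s _; apply/subsetP=> x; rewrite inE => /andP[].
case=> [|i] [|j] x // ltij ltj xF; last by apply: (F2 i j).
by have /subsetP/(_ x xF) := (F1 j ltj).1; rewrite inE => /andP[].
Qed.

Lemma group r X tau k : symmetric r -> 0 < tau ->
  (forall x, x \in X -> #|cmp r X x| < tau) -> 4 * (k * tau) <= #|X| ->
  exists F : nat -> {set T}, (forall i, i < k -> F i \subset X /\ tau <= #|F i|) /\
    (forall i j, i < j -> j < k -> anti r (F i) (F j)).
Proof.
move=> rs tau0 small le.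
have smallL L : L \subset X -> conn r L -> #|L| < tau.
  move=> sL cL; have /set0Pn[x Hx] := cL.1.
  apply: leq_ltn_trans (small x (subsetP sL _ Hx)).
  exact/subset_leq_card/conn_sub_cmp.
pose R (J : {set T}) x := (x \notin J) && [forall b in J, ~~ r b x].
have [->|k0] := posnP k; first by exists (fun=> set0).
have [||F [F1 F2]] := @greedy (fun J : {set T} => tau <= #|J|) R X (2 * tau) _ k; last 2 first.
- by lia.
- exists F; split=> // i j ltij ltj a b Ha Hb; have /andP[nb /forall_inP no] := F2 i j b ltij ltj Hb.
  by split; [apply: contraNneq nb => <- | apply: no].
move=> Z sZ cZ.
have tauZ : tau <= #|Z| by nia.
pose p B := [&& B \subset Z, tau <= #|B| & [forall b in B, forall z in Z :\: B, ~~ r b z]].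
have pZ : p Z.
  rewrite /p subxx tauZ; apply/forall_inP=> b _; apply/forall_inP=> z.
  by rewrite setDv inE.
have [B /minsetP[/and3P[sB cB clB] minB] _] := minset_exists pZ.
exists B; split=> //.
have cB2 : #|B| < 2 * tau.
  have /set0Pn[x Hx] : B != set0 by rewrite -card_gt0; lia.
  have Hxz := subsetP sB _ Hx; have Hxx := subsetP sZ _ Hxz.
  have sD : cmp r Z x \subset B.
    have [|ne] := eqVneq (B :&: cmp r Z x) (cmp r Z x); first by move/setIidPr.
    have [||a [b [Ha Hb nb rab]]] := (cmp_conn rs Hxz).2 (B :&: cmp r Z x) _ _ ne.
    - exact: subsetIr.
    - by apply/set0Pn; exists x; rewrite inE Hx cmp_self.
    move: Ha nb; rewrite !in_setI Hb andbT => /andP[Ha _] nbB.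
    move/forall_inP/(_ a Ha)/forall_inP/(_ b): clB.
    by rewrite inE nbB (subsetP (cmp_sub _ _ _) _ Hb) rab => /(_ isT).
  have cD : #|cmp r Z x| < tau.
    by apply: smallL (cmp_conn rs Hxz); apply: subset_trans (cmp_sub _ _ _) sZ.
  have := cardsID (cmp r Z x) B; rewrite (setIidPr sD).
  have [tauD|] := leqP tau #|B :\: cmp r Z x|; last lia.
  have pD : p (B :\: cmp r Z x).
    rewrite /p tauD (subset_trans (subsetDl _ _) sB) /=.
    apply/forall_inP=> b; rewrite in_setD => /andP[nbD Hb]; apply/forall_inP=> z.
    rewrite !in_setD negb_and negbK => /andP[/orP[zD|nzB] Hz].
      have bD : b \in Z :\: cmp r Z x by rewrite in_setD nbD (subsetP sB).
      by rewrite rs; case: (cmp_anti zD bD).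
    by move/forall_inP/(_ b Hb)/forall_inP/(_ z): clB; rewrite inE nzB Hz => /(_ isT).
  have E := minB _ pD (subsetDl _ _); move/setP/(_ x): E.
  by rewrite in_setD Hx (cmp_self r Hxz).
have sR : Z :\: B \subset [set x in Z | R B x].
  apply/subsetP=> z Hz; move: (Hz); rewrite in_setD => /andP[nz zZ]; rewrite inE zZ /R nz /=.
  by apply/forall_inP=> b Hb; move/forall_inP/(_ b Hb)/forall_inP/(_ z Hz): clB.
have := subset_leq_card sR; have := cardsID B Z; rewrite (setIidPr sB); lia.
Qed.

End Sets.

(** * Double counting *)

Section Count.
Variables (T I : finType) (J : {set I}) (M : {set T}) (P : I -> T -> bool) (a c : nat).

Lemma sum_card_exchange :
  \sum_(i in J) #|[set w in M | P i w]| = \sum_(w in M) #|[set i in J | P i w]|.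
Proof.
transitivity (\sum_(i in J) \sum_(w in M) (P i w : nat)).
  apply: eq_bigr => i _; rewrite -sum1_card big_mkcond [RHS]big_mkcond /=.
  by apply: eq_bigr => w _; rewrite inE; case: (w \in M) (P i w) => [] [].
rewrite exchange_big /=; apply: eq_bigr => w _; rewrite -sum1_card [LHS]big_mkcond [RHS]big_mkcond /=.
by apply: eq_bigr => i _; rewrite inE; case: (i \in J) (P i w) => [] [].
Qed.

Hypothesis Ha : forall i, i \in J -> a <= c * #|[set w in M | P i w]|.

Lemma count_le : #|J| * a <= c * \sum_(w in M) #|[set i in J | P i w]|.
Proof. by rewrite -sum_card_exchange -sum_nat_const big_distrr; apply: leq_sum. Qed.

Lemma count_avg : 0 < #|J| * a ->
  exists2 w, w \in M & #|J| * a <= c * #|M| * #|[set i in J | P i w]|.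
Proof.
move=> pos; apply: NNPP => no.
have lt w : w \in M -> c * #|M| * #|[set i in J | P i w]| < #|J| * a.
  by move=> Hw; rewrite ltnNge; apply/negP=> le; apply: no; exists w.
have M0 : 0 < #|M|.
  move: count_le pos; case: (posnP #|M|) => // /eqP; rewrite cards_eq0 => /eqP->.
  by rewrite big_set0 muln0; lia.
have : #|M| * (#|J| * a) <= \sum_(w in M) c * #|M| * #|[set i in J | P i w]|.
  by rewrite -big_distrr /= [c * _]mulnC -mulnA leq_mul2l count_le orbT.
have : \sum_(w in M) c * #|M| * #|[set i in J | P i w]| <= \sum_(w in M) (#|J| * a).-1.
  by apply: leq_sum => w /lt; lia.
rewrite sum_nat_const; nia.
Qed.

Lemma count_disj : (forall w i j, w \in M -> i \in J -> j \in J -> P i w -> P j w -> i = j) ->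
  #|J| * a <= c * #|M|.
Proof.
move=> inj; apply: leq_trans count_le _; rewrite leq_mul2l -sum1_card; apply/orP; right.
apply: leq_sum => w Hw.
rewrite leqNgt; apply/negP=> /card_gt1P[i [j [/setIdP[Hi Pi] /setIdP[Hj Pj]]]].
by rewrite (inj w i j) ?eqxx.
Qed.
End Count.

(** * Sparse graphs with large components *)

Section P5.
Variables (T : finType) (e : rel T).
Hypotheses (es : symmetric e) (ei : irreflexive e) (P5 : P5_free e).
Implicit Types (C L S X : {set T}).

Lemma no_P5 a b c d f : e a b -> e b c -> e c d -> e d f ->
  ~~ e a c -> ~~ e a d -> ~~ e a f -> ~~ e b d -> ~~ e b f -> ~~ e c f -> False.
Proof.
move=> ab bc cd df ac ad af bd bf cf; apply: P5.
have ba : e b a by rewrite es.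
have cb : e c b by rewrite es.
have dc : e d c by rewrite es.
have fd : e f d by rewrite es.
have ca : ~~ e c a by rewrite es.
have da : ~~ e d a by rewrite es.
have fa : ~~ e f a by rewrite es.
have db : ~~ e d b by rewrite es.
have fb : ~~ e f b by rewrite es.
have fc : ~~ e f c by rewrite es.
exists (fun i : 'I_5 => nth a [:: a; b; c; d; f] i).
have adj (i j : 'I_5) : e (nth a [:: a; b; c; d; f] i) (nth a [:: a; b; c; d; f] j) =
    ((i.+1 == j :> nat) || (j.+1 == i :> nat)).
  case: i j => [[|[|[|[|[|i]]]]] //= _] [[|[|[|[|[|j]]]]] //= _] /=;
    by rewrite ?ei //; apply/idP/idP => //; apply/negP.
split=> // i j eq; apply/val_inj; move: eq.
case: i j => [[|[|[|[|[|i]]]]] //= _] [[|[|[|[|[|j]]]]] //= _] //= eq; exfalso; subst;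
  match goal with
  | H : is_true (e ?x ?x) |- _ => by rewrite ei in H
  | H : is_true (e ?x ?y), H' : is_true (~~ e ?x ?y) |- _ => by rewrite H in H'
  end.
Qed.

(* The complement of a house (a 4-cycle [a b c d] with roof [r] over [ab]) is a path. *)
Lemma no_house a b c d r :
  compl_rel e a b -> compl_rel e b c -> compl_rel e c d -> compl_rel e d a ->
  compl_rel e r a -> compl_rel e r b -> e a c -> e b d -> e r c -> e r d -> False.
Proof.
move=> /andP[_ ab] /andP[_ bc] /andP[_ cd] /andP[_ da] /andP[_ ra] /andP[_ rb] ac bd rc rd.
by apply: (@no_P5 a c r d b) => //; rewrite es.
Qed.

Lemma gyarfas_step C v X L : conn e C -> (exists2 c, c \in C & e v c) ->
  X = [set x in C | (x != v) && ~~ e v x] ->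
  L \subset X -> L != set0 -> anti e L (X :\: L) ->
  exists v', [/\ v' \in C, e v v' & exists2 l, l \in L & e v' l].
Proof.
move=> [_ cC] [c Hc vc] EX sL L0 aL.
have sX : X \subset C by rewrite EX; apply/subsetP=> x; rewrite inE => /andP[].
have neL : L != C.
  by apply: contraTneq vc => LC; move: Hc; rewrite -LC => /(subsetP sL); rewrite EX inE => /and3P[].
have [x [y [Hx Hy nyL xy]]] := cC L (subset_trans sL sX) L0 neL.
have nyX : y \notin X.
  by apply/negP=> yX; have [|_ /negP] := aL x y Hx; rewrite // inE nyL.
move: (subsetP sL _ Hx); rewrite EX inE => /and3P[xC xv vx].
move: nyX; rewrite EX inE Hy /= negb_and !negbK => /orP[/eqP yv|vy].
  by move: vx; rewrite es -yv xy.
by exists y; split=> //; exists x; rewrite // es.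
Qed.

Lemma gyarfas_arith u t : 16 <= u -> 16 <= t -> let w := u * (u * u) in
  [/\ 2 * u <= t * w, 2 * (2 * u * u) <= t * w & 2 * (2 * (2 * u * u) * u) <= t * w] /\
  [/\ 4 * u <= u * w, 4 * (2 * u * u) <= u * w & 4 * (2 * (2 * u * u) * u) <= u * w].
Proof.
move=> u16 t16 w.
have uw : u <= w by rewrite /w leq_pmulr // muln_gt0; lia.
have uuw : u * u <= w by rewrite /w mulnA leq_pmulr //; lia.
have e3 : 2 * (2 * u * u) * u = 4 * w by rewrite /w; nia.
rewrite e3; have -> : 2 * u * u = 2 * (u * u) by nia.
have a : 16 * w <= t * w by rewrite leq_mul2r t16 orbT.
have b : 16 * w <= u * w by rewrite leq_mul2r u16 orbT.
by split; split; lia.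
Qed.

(* Gyarfas path: delete the neighbourhood of the last vertex of the path, pass to a large
   component of what remains, and step towards it. *)
Lemma gyarfas S t : 16 <= t -> 2 * t ^ 16 <= #|S| -> sp e (t ^ 16) S ->
  (forall X, X \subset S -> #|S| <= t ^ 13 * #|X| ->
     exists L, [/\ L \subset X, conn e L, anti e L (X :\: L) & #|X| <= t ^ 4 * #|L|]) -> False.
Proof.
move=> t16 Sbig spS H.
have tp k : 0 < t ^ k by rewrite expn_gt0; lia.
have nbS v C : v \in S -> C \subset S -> 4 * #|S| <= t ^ 16 * #|C| ->
    #|C| <= 2 * #|[set x in C | (x != v) && ~~ e v x]|.
  move=> vS sC cC; set X := [set x in C | _].
  have : #|C| <= #|X| + #|nb e v S| + 1.
    have sub : C \subset (X :|: nb e v S) :|: [set v].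
      apply/subsetP=> x xC; rewrite !inE xC (subsetP sC _ xC) /=.
      by case: eqP; case: (e v x); rewrite ?orbT.
    have := subset_leq_card sub; have := cardsU (X :|: nb e v S) [set v].
    have := cardsU X (nb e v S); rewrite cards1; lia.
  have := spS v vS; have := tp 16; nia.
have e4 : t ^ 16 = t ^ 4 * (t ^ 4 * (t ^ 4 * t ^ 4)) by rewrite -!expnD.
have e13 : t ^ 13 = t * (t ^ 4 * (t ^ 4 * t ^ 4)) by rewrite -[X in X * _]expn1 -!expnD.
have u16 : 16 <= t ^ 4 by rewrite (leq_trans t16) // -[X in X <= _]expn1 leq_pexp2l //; lia.
have u1 := tp 4.
have [|C0 [sC0 cC0 _ cd0]] := H S (subxx _); first by have := tp 13; nia.
have [v1 v1C] : exists v1, v1 \in C0 by apply/set0Pn; case: cC0.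
have := H [set x in C0 | (x != v1) && ~~ e v1 x].
set X1 := [set x in C0 | _] => HX1.
have v1S := subsetP sC0 _ v1C.
set u := t ^ 4 in cd0 e4 e13 u16 u1 *.
have u3 : 0 < u * (u * u) by nia.
have grow K W x y : #|S| <= K * x -> x <= 2 * y -> 2 * K <= W -> #|S| <= W * y.
  move=> le1 le2 le3; apply: leq_trans le1 _; apply: (@leq_trans (K * (2 * y))).
    by rewrite leq_mul2l le2 orbT.
  by rewrite mulnA [K * 2]mulnC leq_mul2r le3 orbT.
have step K x y z : #|S| <= K * x -> x <= 2 * y -> y <= u * z -> #|S| <= 2 * K * u * z.
  move=> le1 le2 le3; apply: leq_trans (grow _ (2 * K) _ _ le1 le2 (leqnn _)) _.
  by rewrite -[X in _ <= X]mulnA leq_mul2l le3 orbT.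
have big4 K x : #|S| <= K * x -> 4 * K <= u * (u * (u * u)) -> 4 * #|S| <= t ^ 16 * x.
  move=> le1 le2; rewrite e4; apply: (@leq_trans (4 * (K * x))); first by rewrite leq_mul2l.
  by rewrite mulnA leq_mul2r le2 orbT.
have [[t1 t2 t3] [k1 k2 k3]] := gyarfas_arith u16 t16.
have big0 : 4 * #|S| <= t ^ 16 * #|C0| by exact: big4 cd0 k1.
have c01 := nbS _ _ v1S sC0 big0; rewrite -/X1 in c01.
have sX1 : X1 \subset C0 by apply/subsetP=> x; rewrite inE => /andP[].
have S1 : X1 \subset S by apply: subset_trans sX1 sC0.
have [|C1 [sC1 cC1 aC1 cd1]] := HX1 S1; first by rewrite e13; exact: grow cd0 c01 t1.
have d1 := step _ _ _ _ cd0 c01 cd1.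
have : exists2 c, c \in C0 & e v1 c.
  have [|||x [y [/set1P-> Hy _ ?]]] := cC0.2 [set v1]; last by exists y.
  - by rewrite sub1set.
  - by apply/set0Pn; exists v1; rewrite inE.
  - apply: contraTneq big0 => <-; rewrite cards1 muln1 -ltnNge; move: (tp 16); clear -Sbig; move: (t ^ 16) Sbig; lia.
move=> /(gyarfas_step cC0)/(_ erefl sC1 cC1.1 aC1)[v2 [v2C v12 v2n]].
have v2S := subsetP sC0 _ v2C.
have SC1 : C1 \subset S by apply: subset_trans sC1 S1.
have big1 : 4 * #|S| <= t ^ 16 * #|C1| by exact: big4 d1 k2.
have := nbS _ _ v2S SC1 big1; have := H [set x in C1 | (x != v2) && ~~ e v2 x].
set X2 := [set x in C1 | _] => HX2 c12.
have sX2 : X2 \subset C1 by apply/subsetP=> x; rewrite inE => /andP[].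
have S2 : X2 \subset S by apply: subset_trans sX2 SC1.
have [|C2 [sC2 cC2 aC2 cd2]] := HX2 S2; first by rewrite e13; exact: grow d1 c12 t2.
have d2 := step _ _ _ _ d1 c12 cd2.
have [v3 [v3C v23 v3n]] := gyarfas_step cC1 v2n erefl sC2 cC2.1 aC2.
have v3S := subsetP SC1 _ v3C.
have SC2 : C2 \subset S by apply: subset_trans sC2 S2.
have big2 : 4 * #|S| <= t ^ 16 * #|C2| by exact: big4 d2 k3.
have := nbS _ _ v3S SC2 big2; have := H [set x in C2 | (x != v3) && ~~ e v3 x].
set X3 := [set x in C2 | _] => HX3 c23.
have sX3 : X3 \subset C2 by apply/subsetP=> x; rewrite inE => /andP[].
have S3 : X3 \subset S by apply: subset_trans sX3 SC2.
have [|C3 [sC3 cC3 aC3 cd3]] := HX3 S3; first by rewrite e13; exact: grow d2 c23 t3.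
have [v4 [v4C v34 [v5 v5C v45]]] := gyarfas_step cC2 v3n erefl sC3 cC3.1 aC3.
have in3 x : x \in C3 -> x \in X3 by apply/subsetP.
have in2 x : x \in C2 -> x \in X2 by apply/subsetP.
have in1 x : x \in C1 -> x \in X1 by apply/subsetP.
have /setIdP[v5C2 /andP[_ n35]] := in3 _ v5C.
have /setIdP[v5C1 /andP[_ n25]] := in2 _ v5C2.
have /setIdP[_ /andP[_ n15]] := in1 _ v5C1.
have /setIdP[v4C1 /andP[_ n24]] := in2 _ v4C.
have /setIdP[_ /andP[_ n14]] := in1 _ v4C1.
have /setIdP[_ /andP[_ n13]] := in1 _ v3C.
exact: (no_P5 v12 v23 v34 v45).
Qed.
End P5.

(** * Fixed density: the neighbourhood of a hub *)

Lemma union_bound (T I : finType) (Q : {set I}) (B : I -> {set T}) (C : {set T}) c m :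
  (forall x, x \in C -> exists2 i, i \in Q & x \in B i) ->
  (forall i, i \in Q -> c * #|B i| <= m) -> c * #|C| <= #|Q| * m.
Proof.
move=> cov HB.
have -> : #|Q| * m = \sum_(i in Q) m by rewrite sum_nat_const.
have : C \subset \bigcup_(i in Q) B i.
  by apply/subsetP=> x /cov[i iQ xB]; apply/bigcupP; exists i.
move/subset_leq_card => le; apply: (@leq_trans (c * #|\bigcup_(i in Q) B i|)).
  by rewrite leq_mul2l le orbT.
apply: (big_rec2 (fun (X : {set T}) n => c * #|X| <= n)); first by rewrite cards0 muln0.
move=> i X n iQ le'; apply: (@leq_trans (c * (#|B i| + #|X|))).
  by rewrite leq_mul2l leq_card_setU orbT.
by rewrite mulnDr leq_add // HB.
Qed.

Lemma few_bad (T : finType) (r : rel T) (X Y : {set T}) a b : symmetric r -> X != set0 ->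
  (forall x, x \in X -> a * #|nb r x Y| <= #|Y|) ->
  a * #|[set y in Y | #|X| < b * #|nb r y X|]| <= b * #|Y|.
Proof.
move=> rs; rewrite -card_gt0 => X0 HX; set B := [set y in Y | _].
have HB y : y \in B -> #|X| <= b * #|[set x in X | r y x]|.
  by rewrite inE => /andP[_ /ltnW].
have le1 := count_le HB; rewrite -(leq_pmul2l X0).
have le2 : a * \sum_(x in X) #|[set y in B | r y x]| <= #|X| * #|Y|.
  rewrite big_distrr -sum_nat_const; apply: leq_sum => x xX /=.
  apply: leq_trans (HX x xX); rewrite leq_mul2l; apply/orP; right.
  by apply/subset_leq_card/subsetP=> y; rewrite !inE rs => /andP[/andP[-> _] ->].
move: le1 le2; clear; move: (\sum_(x in X) _) => s le1 le2.
rewrite mulnCA [#|X| * _]mulnC (leq_trans (n := a * (b * s))) //.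
  by rewrite leq_mul2l le1 orbT.
by rewrite mulnCA [#|X| * _]mulnCA leq_mul2l le2 orbT.
Qed.

Fact lg_key : unit. Proof. exact tt. Qed.
(* Locked, so that the unifier never evaluates powers such as [t ^ 336]. *)
Definition lg := locked_with lg_key (fun t i a b => a <= t ^ i * b).

Section Lg.
Variable t : nat.
Hypothesis t2 : 2 <= t.
Implicit Types (i j a b c : nat).

Lemma lgE i a b : lg t i a b = (a <= t ^ i * b).
Proof. by rewrite /lg unlock. Qed.

Lemma lgt i j a b c : lg t i a b -> lg t j b c -> lg t (i + j) a c.
Proof.
rewrite !lgE => le1 le2; apply: leq_trans le1 _.
by rewrite expnD -mulnA leq_mul2l le2 orbT.
Qed.

Lemma lgw i j a b : lg t i a b -> i <= j -> lg t j a b.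
Proof.
rewrite !lgE => le1 le; apply: leq_trans le1 _; rewrite leq_mul2r leq_pexp2l ?orbT //; lia.
Qed.

Lemma lgm i (T : finType) a (X Y : {set T}) : X \subset Y -> lg t i a #|X| -> lg t i a #|Y|.
Proof.
by rewrite !lgE => /subset_leq_card le le1; apply: leq_trans le1 _; rewrite leq_mul2l le orbT.
Qed.

Lemma lg1 a b : a <= 2 * b -> lg t 1 a b.
Proof. by rewrite lgE => le; apply: leq_trans le _; rewrite expn1 leq_mul2r t2 orbT. Qed.

Lemma lgc i a b : a <= 2 * t ^ i * b -> lg t i.+1 a b.
Proof. by rewrite lgE => le; apply: leq_trans le _; rewrite expnS !leq_mul2r t2 !orbT. Qed.

End Lg.
Arguments lgw [t] t2 [i j a b] & _ _.

Section FixedDensity.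
Variables (T : finType) (e : rel T).
Hypotheses (es : symmetric e) (ei : irreflexive e) (P5 : P5_free e).
Notation h := (compl_rel e).
Implicit Types (B C D J L X Y Z : {set T}).

Lemma hsym : symmetric h.
Proof. by move=> x y; rewrite /compl_rel eq_sym es. Qed.

Lemma heN x y : x != y -> ~~ h x y -> e x y.
Proof. by rewrite /compl_rel => ->; rewrite negbK. Qed.

Lemma h_irr x : h x x = false.
Proof. by rewrite /compl_rel eqxx. Qed.

Definition mix (M B : {set T}) :=
  [set w in M | [exists b in B, h w b] && [exists b in B, ~~ h w b]].

(* In all that follows [v] is a hub: [h]-complete to [A] and [h]-anticomplete to [M]. *)
Variables (t : nat) (A M : {set T}) (v : T).
Hypothesis t64 : 64 <= t.
Hypothesis hubA : forall a, a \in A -> h v a.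
Hypothesis hubM : forall w, w \in M -> e v w.
Hypothesis M0 : 0 < #|M|.
Hypothesis spA : sp h (t ^ 16) A.
Hypothesis notsp : forall B, B \subset A -> sp h (t ^ 32) B -> ~ lg t 336 #|A| #|B|.
Hypothesis mixA : forall B, B \subset A -> lg t 336 #|A| #|B| -> #|M| <= 2 * t * #|mix M B|.
Hypothesis cmpA : forall X, X \subset A -> lg t 336 #|A| #|X| ->
  exists D, [/\ D \subset X, conn e D, anti e D (X :\: D) & lg t 4 #|X| #|D|].

Let t0 : 0 < t. Proof. by lia. Qed.
Let t2 : 2 <= t. Proof. by lia. Qed.
Let tp i : 0 < t ^ i. Proof. by rewrite expn_gt0 t0. Qed.

Lemma M_neq_A w a : w \in M -> a \in A -> w != a.
Proof.
move=> /hubM vw /hubA /andP[_ va]; apply: contraNneq va => <-; exact: vw.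
Qed.

Lemma many_dense_vertices X : X \subset A -> lg t 335 #|A| #|X| ->
  #|X| <= 2 * #|[set x in X | #|X| < 2 * t ^ 32 * #|nb h x X|]|.
Proof.
move=> sX lX; set C := [set x in X | _].
have cID := cardsID C X; rewrite (setIidPr _) in cID; last by apply/subsetP=> x /setIdP[].
have [le|lt] := leqP #|X| (2 * #|X :\: C|); last by clear -cID lt; lia.
have sL : X :\: C \subset A by apply: subset_trans sX; apply: subsetDl.
have sp1 : sp h (t ^ 32) (X :\: C).
  move=> x; rewrite !inE negb_and -leqNgt => /andP[/orP[/negP//|lex] xX].
  have := subset_leq_card (nb_mono h x (subsetDl X C)) => lx.
  move: lex le lx; clear; move: (t ^ 32) => K; nia.
by case: (notsp sL sp1); apply: (lgw t2 (lgt lX (lg1 t2 le))).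
Qed.

Lemma large_cmp X : X \subset A -> lg t 336 #|A| #|X| ->
  exists L, [/\ L \subset X, conn h L, anti h L (X :\: L) & lg t 32 #|X| #|L|].
Proof.
move=> sX lX; case: (boolP [exists x in X, #|X| <= t ^ 32 * #|cmp h X x|]).
  case/exists_inP=> x xX le; exists (cmp h X x); split=> //.
  - exact: cmp_sub.
  - exact: cmp_conn hsym _ xX.
  - exact: cmp_anti.
  - by rewrite lgE.
rewrite negb_exists_in => /forall_inP no.
have sp1 : sp h (t ^ 32) X.
  move=> x xX; move: (no x xX); rewrite -ltnNge => /ltnW; apply: leq_trans.
  by rewrite leq_mul2l subset_leq_card ?orbT // nb_cmp //; exact: hsym.
by case: (notsp sX sp1).
Qed.

Lemma A0 : 0 < #|A|.
Proof.
rewrite lt0n; apply/negP=> /eqP E; case: (@notsp set0); rewrite ?sub0set //.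
  by move=> x; rewrite inE.
by rewrite lgE E.
Qed.

Lemma conn_split r L w : conn r L -> [exists b in L, h w b] -> [exists b in L, ~~ h w b] ->
  exists a b, [/\ a \in L, b \in L, h w a, ~~ h w b & r a b].
Proof.
move=> [_ cL] /exists_inP[a aL wa] /exists_inP[b bL wb].
have [|||x [y [xP yL yP xy]]] := cL (nb h w L); first exact: nb_sub.
- by apply/set0Pn; exists a; rewrite inE aL.
- by apply: contraNneq wb => E; move: bL; rewrite -E inE => /andP[].
exists x, y; move: xP yP; rewrite !inE yL /= => /andP[-> ->] ->; by split.
Qed.

Lemma mix_disj_anti L L' w : L \subset A -> L' \subset A -> conn h L -> conn h L' ->
  anti h L L' -> w \in mix M L -> w \in mix M L' -> False.
Proof.
move=> sL sL' cL cL' an; rewrite !inE => /and3P[wM w1 w2] /andP[_ /andP[w3 _]].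
have [x [c [xL cc wx wc xc]]] := conn_split cL w1 w2.
have /exists_inP[x2 x2L wx2] := w3.
have [ne nh] := an x x2 xL x2L; have [ne' nh'] := an c x2 cc x2L.
have xA := subsetP sL _ xL; have cA := subsetP sL _ cc; have x2A := subsetP sL' _ x2L.
apply: (@no_house _ e es ei P5 v x w x2 c) => //; try exact: heN.
- exact: hubA.
- by rewrite hsym.
- by rewrite hsym hubA.
- by rewrite hsym hubA.
- by rewrite hsym.
- exact: hubM.
- by rewrite es; apply: heN => //; apply: M_neq_A.
Qed.

Lemma mix_disj_compl L L' w : L \subset A -> L' \subset A -> conn e L -> conn e L' ->
  anti e L L' -> w \in mix M L -> w \in mix M L' -> False.
Proof.
move=> sL sL' cL cL' an; rewrite !inE => /and3P[wM w1 w2] /and3P[_ w3 w4].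
have [a [b [aL bL wa wb ab]]] := conn_split cL w1 w2.
have [p [q [pL qL wp wq pq]]] := conn_split cL' w3 w4.
have H x y : x \in L -> y \in L' -> h x y by move=> xL yL; apply/andP; apply: an.
apply: (@no_house _ e es ei P5 a p b q w) => //; try exact: H.
- by rewrite hsym; apply: H.
- by rewrite hsym; apply: H.
- by apply: heN; rewrite ?M_neq_A // (subsetP sL).
- by apply: heN; rewrite ?M_neq_A // (subsetP sL').
Qed.

Lemma nb_small x X : x \in A -> X \subset A -> t ^ 16 * #|nb h x X| <= #|A|.
Proof.
move=> xA sX; apply: leq_trans (spA xA); rewrite leq_mul2l.
by rewrite subset_leq_card ?orbT // nb_mono.
Qed.

Lemma four_pow : 4 * t ^ 4 <= t ^ 16.
Proof.
have -> : t ^ 16 = t ^ 12 * t ^ 4 by rewrite -expnD.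
rewrite leq_mul2r; apply/orP; right; apply: (@leq_trans t); first by lia.
by rewrite -[X in X <= _]expn1 leq_pexp2l.
Qed.

Section Dense.
Variables (A' : {set T}).
Hypothesis sA' : A' \subset A.
Hypothesis halfA' : #|A| <= 2 * #|A'|.
Hypothesis dense : forall J, J \subset A' -> lg t 190 #|A| #|J| -> t ^ 16 * #|J| <= #|A| ->
  lg t 4 #|A| #|[set u in A' | lg t 120 #|J| #|nb h u J|]|.

Lemma dense_nonnbrs v' J : v' \in A' -> J \subset nb h v' A' -> lg t 190 #|A| #|J| ->
  #|A| <= 2 * t ^ 4 * #|[set u in A' | [&& e v' u, lg t 120 #|J| #|nb h u J| &
                                     [exists j in J, ~~ h u j]]]|.
Proof.
move=> v'A sJ lJ; set P := [set u in A' | _].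
have sJ' : J \subset A' by apply: subset_trans sJ (nb_sub _ _ _).
have /card_gt0P[j jJ] : 0 < #|J|.
  by rewrite lt0n; apply: contraTneq lJ => ->; rewrite lgE muln0 -ltnNge; apply: A0.
have jA : j \in A by apply: (subsetP sA'); apply: (subsetP sJ').
have sub : [set u in A' | lg t 120 #|J| #|nb h u J|] \subset (P :|: nb h v' A) :|: nb h j A.
  apply/subsetP=> u /setIdP[uA du]; rewrite !inE uA (subsetP sA' _ uA) du /=.
  case: (boolP [exists j in J, ~~ h u j]) => [/exists_inP[j' j'J nc]|].
    case: (boolP (h v' u)) => [//|nh]; rewrite ?orbT // andbT orbF heN //.
    apply: contraNneq nc => <-; move: (subsetP sJ _ j'J); rewrite inE => /andP[//].
  by rewrite negb_exists_in => /forall_inP/(_ j jJ); rewrite negbK hsym => ->; rewrite !orbT.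
have smJ : t ^ 16 * #|J| <= #|A|.
  apply: leq_trans (nb_small (subsetP sA' _ v'A) sA').
  by rewrite leq_mul2l subset_leq_card ?orbT.
have := dense sJ' lJ smJ; rewrite lgE => le1.
have := subset_leq_card sub; have := leq_card_setU (P :|: nb h v' A) (nb h j A).
have := leq_card_setU P (nb h v' A).
have := nb_small (subsetP sA' _ v'A) (subxx A); have := nb_small jA (subxx A).
have := four_pow; move: le1; clear; move: (t ^ 16) (t ^ 4) => K k.
move=> le1 kK le2 le3 [le4 _] [le5 _] le6; nia.
Qed.

Lemma lg_gt0 i Z : lg t i #|A| #|Z| -> 0 < #|Z|.
Proof.
move=> l; rewrite lt0n; apply: contraTneq l => ->; rewrite lgE muln0 -ltnNge; exact: A0.
Qed.

Lemma extract v' Z : v' \in A' -> Z \subset nb h v' A' -> lg t 34 #|A| #|Z| ->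
  exists J, [/\ J \subset Z, conn h J, lg t 190 #|A| #|J|, t ^ 11 * #|J| <= #|Z| &
    forall z, z \in Z -> z \notin J -> (forall j, j \in J -> h z j) \/ (forall j, j \in J -> ~~ h z j)].
Proof.
move=> v'A sZ lZ.
have sZA : Z \subset A by apply: subset_trans sZ (subset_trans (nb_sub _ _ _) sA').
have := dense_nonnbrs v'A sZ (lgw t2 lZ isT).
set U := [set u in A' | _] => lU.
have [u uU small] : exists2 u, u \in U & t ^ 11 * #|nb h u Z| <= #|Z|.
  apply: NNPP => no.
  have big u : u \in U -> #|Z| <= t ^ 11 * #|[set z in Z | h u z]|.
    by move=> uU; apply: ltnW; rewrite ltnNge; apply/negP=> le; apply: no; exists u.
  have := count_le big.
  have : t ^ 16 * (\sum_(z in Z) #|[set u in U | h u z]|) <= #|Z| * #|A|.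
    rewrite big_distrr -sum_nat_const; apply: leq_sum => z zZ /=.
    apply: leq_trans (nb_small (subsetP sZA _ zZ) (subxx A)).
    rewrite leq_mul2l; apply/orP; right; apply/subset_leq_card/subsetP=> x.
    by rewrite !inE hsym => /andP[/andP[xA _] ->]; rewrite (subsetP sA').
  have := lg_gt0 lZ; have A00 := A0; move: lU A00.
  have -> : t ^ 16 = t ^ 11 * (t * t ^ 4) by rewrite -expnS -expnD.
  have := tp 4; have := tp 11; move: t64; clear; move: (\sum_(z in Z) _) => s.
  move: (t ^ 11) (t ^ 4) => K k t64 K0 k0 lU A00 Z0 le1 le2.
  have : (t * k) * (#|U| * #|Z|) <= #|Z| * #|A|.
    by apply: leq_trans le1; rewrite [K * _]mulnC -[in X in _ <= X]mulnA leq_mul2l le2 orbT.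
  rewrite [_ * #|Z|]mulnC mulnCA leq_pmul2l // => le3.
  have : t * (k * #|U|) <= 2 * (k * #|U|) by move: (leq_trans le3 lU); rewrite -!mulnA.
  rewrite leq_mul2r => /orP[/eqP|]; last by lia.
  by move=> E; move: lU; rewrite -mulnA E muln0; lia.
move: uU; rewrite inE => /and4P[uA v'u du _].
set X := nb h u Z in du small.
have sXZ : X \subset Z := nb_sub _ _ _.
have sXA := subset_trans sXZ sZA.
have lX := lgt lZ du.
have [D [sDX cD aD lD]] := cmpA sXA (lgw t2 lX isT).
have lD' := lgt lX lD.
have sDA := subset_trans sDX sXA.
have [J [sJD cJ aJ lJ]] := large_cmp sDA (lgw t2 lD' isT).
exists J; split=> //.
- by apply: subset_trans (subset_trans sJD sDX) sXZ.
- exact: lgt lD' lJ.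
- apply: leq_trans small; rewrite leq_mul2l subset_leq_card ?orbT //.
  exact: subset_trans sJD sDX.
move=> z zZ zJ; case: (boolP (z \in D)) => zD.
  right=> j jJ; rewrite hsym; have [|//] := aJ j z jJ; first by rewrite inE zJ.
case: (boolP (z \in X)) => zX.
  left=> j jJ; have [|ne nh] := aD j z (subsetP sJD _ jJ); first by rewrite inE zD.
  by rewrite hsym /compl_rel ne.
have zA := subsetP sZA _ zZ.
case: (boolP [exists j in D, h z j]) => [c1|]; last first.
  by rewrite negb_exists_in => /forall_inP n; right=> j jJ; apply: n; apply: (subsetP sJD).
case: (boolP [exists j in D, ~~ h z j]) => [c2|]; last first.
  rewrite negb_exists_in => /forall_inP n; left=> j jJ.
  by have := n j (subsetP sJD _ jJ); rewrite negbK.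
have [a [b [aD' bD za zb ab]]] := conn_split cD c1 c2.
have hv' x : x \in Z -> h v' x by move=> /(subsetP sZ); rewrite inE => /andP[].
have hu x : x \in D -> h u x by move=> /(subsetP sDX); rewrite inE => /andP[].
have inZ x : x \in D -> x \in Z by move=> /(subsetP sDX) /(subsetP sXZ).
have nzu : ~~ h u z by move: zX; rewrite inE zZ.
exfalso; apply: (@no_house _ e es ei P5 v' a u b z) => //.
- exact/hv'/inZ.
- by rewrite hsym hu.
- exact: hu.
- by rewrite hsym; apply/hv'/inZ.
- by rewrite hsym; apply/hv'.
- apply: heN; last by rewrite hsym.
  apply: contraTneq v'u => <-; move: (hv' z zZ); rewrite /compl_rel => /andP[_]; exact.
- by apply: heN => //; apply: contraNneq zD => ->.
Qed.

Lemma dense_case_false : False.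
Proof.
have lA' : lg t 1 #|A| #|A'| by apply: lg1.
have cA' := many_dense_vertices sA' (lgw t2 lA' isT).
have [v' v'A big] : exists2 v', v' \in A' & #|A'| < 2 * t ^ 32 * #|nb h v' A'|.
  have /card_gt0P[v'] : 0 < #|[set x in A' | #|A'| < 2 * t ^ 32 * #|nb h x A'|]|.
    have A'0 := lg_gt0 lA'; have := leq_trans A'0 cA'; by rewrite muln_gt0.
  by rewrite inE => /andP[v'A big]; exists v'.
set Y := nb h v' A' in big.
have lgZ Z : #|Y| <= 2 * #|Z| -> lg t 34 #|A| #|Z|.
  move: big halfA' t64; rewrite lgE (_ : t ^ 34 = t * (t * t ^ 32)); last by rewrite -!expnS.
  clear; move: (t ^ 32) => K; move=> le1 le2 le3 le4.
  apply: (@leq_trans (8 * (K * #|Z|))); first by nia.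
  rewrite -!mulnA mulnCA; have : 8 <= t * t by nia.
  by rewrite -[t * (K * _)]mulnCA; nia.
pose good J := conn h J /\ lg t 190 #|A| #|J|.
pose R J z := (z \notin J) && ([forall j in J, h z j] || [forall j in J, ~~ h z j]).
have [||F [F1 F2]] := @greedy T good R Y (#|Y| %/ t ^ 11) _ (t ^ 10).
- move=> Z sZ lZ; have [J [sJ cJ lJ smJ pJ]] := extract v'A sZ (lgZ Z lZ).
  exists J; split=> //.
  have sub : Z :\: J \subset [set x in Z | R J x].
    apply/subsetP=> z; rewrite in_setD => /andP[zJ zZ]; rewrite inE zZ /R zJ /=.
    have [hz|hz] := pJ z zZ zJ; first by rewrite (introT forall_inP hz).
    by rewrite (introT forall_inP hz) orbT.
  have := subset_leq_card sub; have := cardsID J Z; rewrite (setIidPr sJ).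
  have : #|J| <= #|Y| %/ t ^ 11.
    by rewrite leq_divRL ?tp // mulnC (leq_trans smJ) // subset_leq_card.
  clear; move: (_ %/ _) => c; lia.
- have := leq_trunc_div #|Y| (t ^ 11).
  have -> : t ^ 11 = t * t ^ 10 by rewrite -expnS.
  move: t64; clear; move: (t ^ 10) (#|Y| %/ _) => K c; nia.
have sY : Y \subset A by apply: subset_trans (nb_sub _ _ _) sA'.
pose P (i : 'I_(t ^ 10)) u :=
  [&& e v' u, lg t 120 #|F i| #|nb h u (F i)| & [exists j in F i, ~~ h u j]].
have HP (i : 'I_(t ^ 10)) : i \in setT -> #|A| <= 2 * t ^ 4 * #|[set u in A' | P i u]|.
  by move=> _; have [sF [_ lF]] := F1 i (ltn_ord i); apply: dense_nonnbrs.
have [|m mA] := count_avg HP.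
  by rewrite cardsT card_ord muln_gt0 tp A0.
set I := [set i in _ | _]; rewrite cardsT card_ord => le.
have bigI : 2 * t < #|I|.
  rewrite ltnNge; apply/negP; move: le; move: #|I| => i le leI.
  move: le; have := subset_leq_card sA'; have := A0.
  have -> : t ^ 10 = t ^ 4 * (t * (t * t ^ 4)) by rewrite -!expnS -expnD.
  move: leI t64 (tp 4); clear; move: (t ^ 4) #|A| #|A'| => K a a' leI t64 K0 a0 lea le.
  have : K * (t * (t * K)) * a <= 2 * K * a * (2 * t).
    by apply: leq_trans le _; apply: leq_mul => //; rewrite leq_mul2l lea orbT.
  rewrite (_ : 2 * K * a * (2 * t) = (4 * K * t) * a); last by nia.
  rewrite leq_pmul2r // (_ : 4 * K * t = K * (t * 4)); last by nia.
  rewrite leq_pmul2l // leq_pmul2l; [nia | by lia].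
have exE (i : 'I_(t ^ 10)) : exists E : {set T}, i \in I ->
    [/\ E \subset nb h m (F i), conn e E & lg t 336 #|A| #|E|].
  case: (boolP (i \in I)) => [|_]; last by exists set0.
  rewrite inE => /andP[_ /and3P[_ dn _]].
  have [sF [_ lF]] := F1 i (ltn_ord i).
  have lD := lgt lF dn.
  have sDA : nb h m (F i) \subset A by apply: subset_trans (nb_sub _ _ _) (subset_trans sF sY).
  have [E [sE cE _ lE]] := cmpA sDA (lgw t2 lD isT).
  by exists E => _; split=> //; apply: (lgw t2 (lgt lD lE)).
have [E HE] := fin_all_exists exE.
have antiE (i j : 'I_(t ^ 10)) : i < j -> i \in I -> j \in I -> anti e (E i) (E j).
  move=> ltij iI jI a b aE bE.
  have [sEi cEi lEi] := HE i iI; have [sEj cEj lEj] := HE j jI.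
  have := subsetP sEi _ aE; have := subsetP sEj _ bE; rewrite !inE => /andP[bF mb] /andP[aF ma].
  have /andP[nbF /orP[/forall_inP pure|/forall_inP pure]] := F2 i j b ltij (ltn_ord j) bF.
    by have := pure a aF; rewrite hsym => /andP[-> ->].
  have [sFi [cFi _]] := F1 i (ltn_ord i); have [sFj _] := F1 j (ltn_ord j).
  have c1 : [exists x in F i, h m x] by apply/exists_inP; exists a.
  have c2 : [exists x in F i, ~~ h m x] by move: iI; rewrite inE => /andP[_ /and3P[]].
  have v'm : e v' m by move: iI; rewrite inE => /andP[_ /and3P[]].
  have [x1 [c [x1F cF mx1 mc x1c]]] := conn_split cFi c1 c2.
  have hvi x : x \in F i -> h v' x by move=> /(subsetP sFi); rewrite inE => /andP[].
  have hvj x : x \in F j -> h v' x by move=> /(subsetP sFj); rewrite inE => /andP[].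
  exfalso; apply: (@no_house _ e es ei P5 v' x1 m b c) => //.
  - exact: hvi.
  - by rewrite hsym.
  - by rewrite hsym hvj.
  - by rewrite hsym hvi.
  - by rewrite hsym.
  - by rewrite es; apply: heN; [apply: contraNneq nbF => -> | apply: pure].
  - apply: heN; last by rewrite hsym.
    by apply: contraTneq v'm => <-; have := hvi c cF; rewrite /compl_rel => /andP[_].
  - by rewrite es; apply: heN; [apply: contraNneq nbF => -> | apply: pure].
have HM (i : 'I_(t ^ 10)) : i \in I -> #|M| <= 2 * t * #|mix M (E i)|.
  move=> iI; have [sE _ lE] := HE i iI; apply: mixA => //.
  have [sF _] := F1 i (ltn_ord i).
  by apply: subset_trans sE (subset_trans (nb_sub _ _ _) (subset_trans sF sY)).
have := count_disj HM; rewrite leq_pmul2r // leqNgt bigI => H; suff : false by []; apply: H.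
have wlog_lt w (i j : 'I_(t ^ 10)) : i < j -> i \in I -> j \in I ->
    w \in mix M (E i) -> w \in mix M (E j) -> False.
  move=> ltij iI jI; have [sEi cEi _] := HE i iI; have [sEj cEj _] := HE j jI.
  have [sFi _] := F1 i (ltn_ord i); have [sFj _] := F1 j (ltn_ord j).
  apply: mix_disj_compl => //; last exact: antiE.
    by apply: subset_trans sEi (subset_trans (nb_sub _ _ _) (subset_trans sFi sY)).
  by apply: subset_trans sEj (subset_trans (nb_sub _ _ _) (subset_trans sFj sY)).
move=> w i j wM iI jI wi wj; apply/val_inj.
have {}wi : w \in mix M (E i) by rewrite inE wM.
have {}wj : w \in mix M (E j) by rewrite inE wM.
by case: (ltngtP i j) => // lt; [case: (wlog_lt w i j) | case: (wlog_lt w j i)].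
Qed.
End Dense.

Section Sparse.
Hypothesis sparse : forall A' : {set T}, A' \subset A -> #|A| <= 2 * #|A'| ->
  exists J, [/\ J \subset A', lg t 190 #|A| #|J|, t ^ 16 * #|J| <= #|A| &
    t ^ 4 * #|[set u in A' | lg t 120 #|J| #|nb h u J|]| < #|A|].

Lemma sparse_family : exists F : nat -> {set T},
  (forall i : nat, i < t ^ 3 -> F i \subset A /\ lg t 190 #|A| #|F i|) /\
  (forall i j (x : T), i < j -> j < t ^ 3 -> x \in F j ->
     x \notin F i /\ t ^ 120 * #|nb h x (F i)| <= #|F i|).
Proof.
pose R (J : {set T}) (x : T) := (x \notin J) && ~~ lg t 120 #|J| #|nb h x J|.
have [||F [F1 F2]] := @greedy T (fun J => lg t 190 #|A| #|J|) R A
    (#|A| %/ t ^ 4 + #|A| %/ t ^ 16) _ (t ^ 3).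
- move=> Z sZ lZ; have [J [sJ lJ smJ fewJ]] := sparse sZ lZ.
  exists J; split=> //; set U := [set u in Z | _] in fewJ.
  have sub : Z \subset ([set x in Z | R J x] :|: U) :|: J.
    apply/subsetP=> z zZ; rewrite !inE zZ /R; case: (z \in J); rewrite ?orbT //=.
    by rewrite orbF orNb.
  have := subset_leq_card sub; have := leq_card_setU ([set x in Z | R J x] :|: U) J.
  have := leq_card_setU [set x in Z | R J x] U.
  have : #|J| <= #|A| %/ t ^ 16 by rewrite leq_divRL ?tp // mulnC.
  have : #|U| <= #|A| %/ t ^ 4 by rewrite leq_divRL ?tp // mulnC ltnW.
  clear; move: (_ %/ _) (_ %/ _) => c c' l1 l2 [l3 _] [l4 _] l5; lia.
- have := leq_trunc_div #|A| (t ^ 4).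
  have : #|A| %/ t ^ 16 <= #|A| %/ t ^ 4 by apply: leq_div2l; rewrite ?tp ?leq_pexp2l.
  have -> : t ^ 4 = t * t ^ 3 by rewrite -expnS.
  move: t64; clear; move: (#|A| %/ t ^ 16) => c'; move: (t ^ 3) => K.
  by move: (#|A| %/ _) => c; nia.
exists F; split=> [//|i j x ltij ltj xF].
have /andP[-> nl] := F2 i j x ltij ltj xF; split=> //.
by move: nl; rewrite lgE -ltnNge => /ltnW.
Qed.

Lemma spread : exists G : 'I_(t ^ 3) -> {set T},
  [/\ forall i, G i \subset A, forall i, lg t 191 #|A| #|G i|,
    forall i j (x : T), i != j -> x \in G i -> x \notin G j &
    forall i j (x : T), i != j -> x \in G j -> t ^ 99 * #|nb h x (G i)| <= #|G i| ].
Proof.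
have [F [F1 F2]] := sparse_family.
pose Bad i j := [set x in F i | #|F j| < t ^ 100 * #|nb h x (F j)|].
pose G (i : 'I_(t ^ 3)) := [set x in F i | [forall j : 'I_(t ^ 3), (i < j) ==> (x \notin Bad i j)]].
have sG i : G i \subset F i by apply/subsetP=> x; rewrite inE => /andP[].
have F0 i : i < t ^ 3 -> F i != set0.
  by move=> lti; rewrite -card_gt0; apply: (@lg_gt0 190); have [] := F1 i lti.
have halfG (i : 'I_(t ^ 3)) : #|F i| <= 2 * #|G i|.
  have : t ^ 20 * #|F i :\: G i| <= #|[set j : 'I_(t ^ 3) | i < j]| * #|F i|.
    apply: (@union_bound _ _ _ (fun j : 'I_(t ^ 3) => Bad i j)).
      move=> x; rewrite in_setD => /andP[xG xF]; move: xG; rewrite in_set xF /= negb_forall.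
      by case/existsP=> j; rewrite negb_imply negbK => /andP[ltij xB]; exists j => //; rewrite inE.
    move=> j; rewrite inE => ltij.
    have := @few_bad T h (F j) (F i) (t ^ 120) (t ^ 100) hsym (F0 _ (ltn_ord j)).
    rewrite (_ : t ^ 120 = t ^ 100 * t ^ 20); last by rewrite -expnD.
    rewrite -[_ * _ * #|[set _ in _ | _]|]mulnA leq_pmul2l ?tp //; apply=> x xF.
    have [_] := F2 i j x ltij (ltn_ord j) xF; by rewrite -expnD.
  have leI : #|[set j : 'I_(t ^ 3) | i < j]| <= t ^ 3.
    by rewrite -[X in _ <= X]card_ord max_card.
  have := cardsID (G i) (F i); rewrite (setIidPr (sG i)).
  rewrite (_ : t ^ 20 = t ^ 3 * (t * t ^ 16)); last by rewrite -expnS -expnD.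
  move: leI (tp 3) (tp 16) t64; move: #|[set _ | _]| #|F i :\: G i| #|F i| #|G i| => n d f g.
  clear; move: (t ^ 3) (t ^ 16) => K k le K0 k0 t64 E le2.
  have : K * (t * k * d) <= K * f.
    by rewrite mulnA (leq_trans le2) // leq_mul2r le orbT.
  rewrite leq_pmul2l //; have : 2 * d <= t * k * d by rewrite leq_mul2r; apply/orP; right; nia.
  by move: E; clear; move: (t * k * d) => s; lia.
have disj (i j : 'I_(t ^ 3)) (x : T) : i < j -> x \in G j -> x \notin F i.
  by move=> ltij xG; have [] := F2 i j x ltij (ltn_ord j) (subsetP (sG j) _ xG).
exists G; split.
- by move=> i; apply: subset_trans (sG i) (F1 i (ltn_ord i)).1.
- by move=> i; apply: (lgt (F1 i (ltn_ord i)).2 (lg1 t2 (halfG i))).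
- move=> i j x; rewrite -val_eqE neq_ltn => /orP[] ltij xG.
    by apply/negP=> xGj; move: (disj _ _ _ ltij xGj); rewrite (subsetP (sG i) _ xG).
  apply: contra (disj _ _ _ ltij xG); exact/subsetP.
move=> i j x ne xG.
have : t ^ 100 * #|nb h x (F i)| <= #|F i|.
  move: ne; rewrite -val_eqE neq_ltn => /orP[] ltij.
    have [_ le] := F2 i j x ltij (ltn_ord j) (subsetP (sG j) _ xG).
    by apply: leq_trans le; rewrite leq_mul2r leq_pexp2l ?orbT.
  move: xG; rewrite inE => /andP[xF /forallP/(_ i)]; rewrite ltij /= inE xF /=.
  by rewrite -leqNgt.
have := subset_leq_card (nb_mono h x (sG i)); have := halfG i.
have : t ^ 100 = t * t ^ 99 by rewrite -expnS.
move: t64; clear; move: (t ^ 99) (t ^ 100) => K K' t64 E100 le1 le2 le3.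
have : t * (K * #|nb h x (G i)|) <= 2 * #|G i|.
  apply: leq_trans _ le1; apply: leq_trans _ le3; by rewrite E100 mulnA leq_mul2l le2 orbT.
have : 2 * (K * #|nb h x (G i)|) <= t * (K * #|nb h x (G i)|) by rewrite leq_mul2r; lia.
lia.
Qed.

Lemma wedge X : X \subset A -> lg t 191 #|A| #|X| ->
  exists S : {set T}, [/\ S \subset X, lg t 34 #|X| #|S| &
    forall w, w \in mix M S -> exists x c (W : {set T}),
      [/\ [/\ x \in X, c \in X & h x c], h w x /\ ~~ h w c,
        W \subset X /\ lg t 66 #|X| #|W| & forall y, y \in W -> h x y /\ h c y]].
Proof.
move=> sX lX.
have big Y : Y \subset A -> lg t 335 #|A| #|Y| -> exists2 y, y \in Y & #|Y| < 2 * t ^ 32 * #|nb h y Y|.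
  move=> sY lY; have cY := many_dense_vertices sY lY.
  have /card_gt0P[y] : 0 < #|[set y in Y | #|Y| < 2 * t ^ 32 * #|nb h y Y|]|.
    by have := leq_trans (lg_gt0 lY) cY; rewrite muln_gt0.
  by rewrite inE => /andP[yY bigy]; exists y.
have [p pX /ltnW /lgc lN] := big X sX (lgw t2 lX isT).
have {}lN : lg t 33 #|X| #|nb h p X| by apply: lN.
set N := nb h p X in lN.
have sNX : N \subset X := nb_sub _ _ _.
have sN : N \subset A := subset_trans sNX sX.
have lAN := lgt lX lN.
have cN := many_dense_vertices sN (lgw t2 lAN isT).
set Z := [set _ in N | _] in cN.
have sZN : Z \subset N by apply/subsetP=> z /setIdP[].
have hp y : y \in N -> h p y by rewrite inE => /andP[].
exists (p |: Z); split.
- by rewrite subUset sub1set pX (subset_trans sZN).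
- by apply: (lgm (subsetUr _ _)); apply: (lgt lN (lg1 t2 cN)).
move=> w; rewrite inE => /and3P[_ /exists_inP[b1 b1S w1] /exists_inP[b2 b2S w2]].
have W z : z \in Z -> [/\ nb h z N \subset X, lg t 66 #|X| #|nb h z N| &
    forall y, y \in nb h z N -> h p y /\ h z y].
  rewrite inE => /andP[zN /ltnW bigz]; split.
  - exact: subset_trans (nb_sub _ _ _) sNX.
  - exact: (lgt lN (lgc t2 bigz)).
  by move=> y; rewrite in_set => /andP[/hp].
case: (boolP (h w p)) => wp.
  move: b2S; rewrite in_setU1; case: eqP w2 => [->|_] w2 /=; first by rewrite wp in w2.
  move=> b2Z; have [W1 W2 W3] := W _ b2Z; exists p, b2, (nb h b2 N); split=> //.
  by split=> //; [apply: (subsetP sNX); apply: (subsetP sZN) | apply: hp; apply: (subsetP sZN)].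
move: b1S; rewrite in_setU1; case: eqP w1 => [->|_] w1 /=; first by rewrite w1 in wp.
move=> b1Z; have [W1 W2 W3] := W _ b1Z; exists b1, p, (nb h b1 N); split=> //.
  split=> //; first by apply: (subsetP sNX); apply: (subsetP sZN).
  by rewrite hsym; apply: hp; apply: (subsetP sZN).
by move=> y /W3[].
Qed.

Lemma sparse_case_false : False.
Proof.
have [G [sG lG disj few]] := spread.
have [S HS] := fin_all_exists (fun i => wedge (sG i) (lG i)).
have HM (i : 'I_(t ^ 3)) : i \in setT -> #|M| <= 2 * t * #|mix M (S i)|.
  move=> _; have [sS lS _] := HS i; apply: mixA; first exact: subset_trans sS (sG i).
  exact: (lgw t2 (lgt (lG i) lS) isT).
have [|w wM] := count_avg HM; first by rewrite cardsT card_ord muln_gt0 tp M0.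
set I := [set i in _ | _]; rewrite cardsT card_ord mulnAC leq_pmul2r // => bigI.
have exx (i : 'I_(t ^ 3)) : exists x, i \in I -> exists c (W : {set T}),
      [/\ [/\ x \in G i, c \in G i & h x c], h w x /\ ~~ h w c,
        W \subset G i /\ lg t 66 #|G i| #|W| & forall y, y \in W -> h x y /\ h c y].
  case: (boolP (i \in I)) => [iI|_]; last by exists w.
  have [_ _ HW] := HS i; have [|x Hx] := HW w; last by exists x.
  by move: iI; rewrite !inE wM.
have {exx}[x exc] := fin_all_exists exx.
have {}exc (i : 'I_(t ^ 3)) : exists c, i \in I -> exists W : {set T},
      [/\ [/\ x i \in G i, c \in G i & h (x i) c], h w (x i) /\ ~~ h w c,
        W \subset G i /\ lg t 66 #|G i| #|W| & forall y, y \in W -> h (x i) y /\ h c y].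
  case: (boolP (i \in I)) => [iI|_]; last by exists w.
  by have [c Hc] := exc i iI; exists c.
have [c exW] := fin_all_exists exc.
have {exc}{}exW (i : 'I_(t ^ 3)) : exists W : {set T}, i \in I ->
      [/\ [/\ x i \in G i, c i \in G i & h (x i) (c i)], h w (x i) /\ ~~ h w (c i),
        W \subset G i /\ lg t 66 #|G i| #|W| & forall y, y \in W -> h (x i) y /\ h (c i) y].
  case: (boolP (i \in I)) => [iI|_]; last by exists set0.
  by have [W HW] := exW i iI; exists W.
have [W HW] := fin_all_exists exW.
have vG (i : 'I_(t ^ 3)) y : y \in G i -> h v y by move=> /(subsetP (sG i)) /hubA.
have neG (i l : 'I_(t ^ 3)) a b : i != l -> a \in G i -> b \in G l -> a != b.
  by move=> ne aG bG; apply: contraNneq (disj i l a ne aG) => ->.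
have ew y : y \in A -> ~~ h w y -> e y w.
  by move=> yA n; rewrite es; apply: heN => //; apply: M_neq_A.
(* A hub cycle [v x_i w x_l] with roof [c_i] forces a crossing edge. *)
have cross (i l : 'I_(t ^ 3)) : i \in I -> l \in I -> i != l ->
    exists a b, [/\ a = x i \/ a = c i, b = x l & h a b].
  move=> iI lI ne; have [[xi ci xci] [wx wc] _ _] := HW i iI; have [[xl cl xcl] [wxl wcl] _ _] := HW l lI.
  case: (boolP (h (x i) (x l))) => [hh|nh]; first by exists (x i), (x l); split=> //; left.
  case: (boolP (h (c i) (x l))) => [hh|nh']; first by exists (c i), (x l); split=> //; right.
  exfalso; apply: (@no_house _ e es ei P5 v (x i) w (x l) (c i)) => //.
  - exact: vG xi.
  - by rewrite hsym.
  - by rewrite hsym (vG _ _ xl).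
  - by rewrite hsym (vG _ _ ci).
  - by rewrite hsym.
  - exact: hubM.
  - by apply: heN => //; apply: neG xi xl.
  - by apply: ew => //; apply: (subsetP (sG i)).
  - by apply: heN => //; apply: neG ci xl.
pose C i := [set y in W i | #|W i| < 2 * t ^ 32 * #|nb h y (W i)|].
pose C' (i : 'I_(t ^ 3)) := [set y in C i | [forall l in I :\ i, ~~ h (x l) y && ~~ h (c l) y]].
have sC i : C i \subset W i by apply/subsetP=> y /setIdP[].
have sC' i : C' i \subset C i by apply/subsetP=> y /setIdP[].
have sWA i : i \in I -> W i \subset A.
  by move=> iI; have [_ _ [sW _] _] := HW i iI; apply: subset_trans sW (sG i).
have lW i : i \in I -> lg t 257 #|A| #|W i|.
  by move=> iI; have [_ _ [_ lw] _] := HW i iI; apply: (lgt (lG i) lw).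
have cW i : i \in I -> #|W i| <= 2 * #|C i|.
  by move=> iI; apply: many_dense_vertices (sWA i iI) (lgw t2 (lW i iI) isT).
have cC i : i \in I -> #|C i| <= 2 * #|C' i|.
  move=> iI; have [_ _ [sW lw] _] := HW i iI.
  have few' : t ^ 99 * #|C i :\: C' i| <= #|I :\ i| * (2 * #|G i|).
    apply: (@union_bound _ _ _ (fun l => nb h (x l) (G i) :|: nb h (c l) (G i))).
      move=> y; rewrite in_setD => /andP[yC' yC]; move: yC'; rewrite in_set yC /=.
      rewrite negb_forall_in => /exists_inP[l lI nn]; exists l => //.
      have yG : y \in G i by apply: (subsetP sW); apply: (subsetP (sC i)).
      by rewrite in_setU !in_set yG /=; move: nn; rewrite negb_and !negbK.
    move=> l; rewrite in_setD1 => /andP[ne lI]; have [[xl cl _] _ _ _] := HW l lI.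
    rewrite eq_sym in ne.
    have := few i l _ ne xl; have := few i l _ ne cl.
    have := leq_card_setU (nb h (x l) (G i)) (nb h (c l) (G i)).
    move: #|_ :|: _| #|nb h (x l) _| #|nb h (c l) _| => n1 n2 n3 [le1 _] le2 le3.
    apply: (@leq_trans (t ^ 99 * (n2 + n3))); first by rewrite leq_mul2l le1 orbT.
    by rewrite mulnDr mul2n -addnn leq_add.
  have leI : #|I :\ i| <= t ^ 3.
    by rewrite -[X in _ <= X]card_ord max_card.
  have := cardsID (C' i) (C i); rewrite (setIidPr (sC' i)); have := cW i iI.
  move: lw few' leI; rewrite lgE (_ : t ^ 99 = t ^ 3 * (t ^ 66 * (t ^ 29 * t))); last first.
    by rewrite -expnSr -!expnD.
  move: (tp 3) (tp 66) (tp 29) t64.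
  move: #|I :\ i| #|G i| #|W i| #|C i| #|C' i| #|C i :\: C' i| => n g ww cc c' d.
  clear; move: (t ^ 3) (t ^ 66) (t ^ 29) => K L k K0 L0 k0 t64 le1 le2 le3 le4 E.
  have : K * (L * (k * t * d)) <= K * (L * (4 * cc)).
    rewrite [L * _]mulnA mulnA (leq_trans le2) //; apply: leq_mul => //.
    apply: (@leq_trans (2 * (L * (2 * cc)))); last by lia.
    by rewrite leq_mul2l (leq_trans le1) // leq_mul2l le4 orbT.
  rewrite !leq_pmul2l // => le5.
  have : 64 * d <= k * t * d by rewrite leq_mul2r; apply/orP; right; nia.
  by move: le5 E; clear; move: (k * t * d) => s; lia.
have antiC (i l : 'I_(t ^ 3)) : i \in I -> l \in I -> i != l -> anti h (C' i) (C' l).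
  move=> iI lI ne y y' yC' y'C'.
  have yW := subsetP (sC i) _ (subsetP (sC' i) _ yC').
  have y'W := subsetP (sC l) _ (subsetP (sC' l) _ y'C').
  have [[xi ci _] _ [sWi lw] hW] := HW i iI; have [[xl cl _] _ [sWl _] hW'] := HW l lI.
  have yG := subsetP sWi _ yW; have y'G := subsetP sWl _ y'W.
  split; first exact: neG ne yG y'G.
  apply/negP=> hyy'.
  have [a [b [Ea Eb hab]]] := cross i l iI lI ne.
  have nil : l \in I :\ i by rewrite in_setD1 eq_sym ne.
  have nli : i \in I :\ l by rewrite in_setD1 ne.
  have nby q : q \in C' i -> ~~ h b q.
    by rewrite in_set => /andP[_ /forall_inP/(_ l nil)/andP[n1 _]]; rewrite Eb.
  have nay : ~~ h a y'.
    move: y'C'; rewrite in_set => /andP[_ /forall_inP/(_ i nli)/andP[n1 n2]].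
    by case: Ea => ->.
  have aG : a \in G i by case: Ea => ->.
  have bG : b \in G l by rewrite Eb.
  have haW q : q \in W i -> h a q by move=> /hW[h1 h2]; case: Ea => ->.
  have hby' : h b y' by rewrite Eb; have [] := hW' _ y'W.
  have [q qW [nqy' nqb]] : exists2 q, q \in nb h y (W i) & ~~ h q y' /\ ~~ h q b.
    apply: NNPP => no.
    have sub : nb h y (W i) \subset nb h y' (G i) :|: nb h b (G i).
      apply/subsetP=> q qn; have qG : q \in G i.
        by apply: (subsetP sWi); apply: (subsetP (nb_sub _ _ _) _ qn).
      rewrite in_setU !in_set qG /=; apply/negP=> /negP; rewrite negb_or => /andP[n1 n2].
      by apply: no; exists q => //; rewrite ![h q _]hsym.
    have := subset_leq_card sub; have := leq_card_setU (nb h y' (G i)) (nb h b (G i)).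
    have := few i l _ ne y'G; have := few i l _ ne bG.
    have := subsetP (sC' i) _ yC'; rewrite in_set => /andP[_].
    move: lw; rewrite lgE (_ : t ^ 99 = t ^ 66 * (t ^ 32 * t)); last by rewrite -expnSr -!expnD.
    move: (tp 66) (tp 32) t64.
    move: #|_ :|: _| #|nb h y _| #|nb h y' _| #|nb h b _| #|G i| #|W i| => u n n1 n2 g ww.
    clear; move: (t ^ 66) (t ^ 32) => L K L0 K0 t64 le1 le2 le3 le4 [le5 _] le6.
    have : L * (K * t * n) <= L * (2 * ww).
      apply: (@leq_trans (2 * g)).
        rewrite mulnA (@leq_trans (L * (K * t) * (n1 + n2))) //.
          by rewrite leq_mul2l (leq_trans le6) // orbT.
        by rewrite mulnDr mul2n -addnn leq_add.
      by rewrite mulnCA leq_mul2l.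
    rewrite leq_pmul2l // => le7.
    have : K * t * n <= 4 * K * n by lia.
    rewrite leq_mul2r => /orP[/eqP n0|]; last by nia.
    by move: le2; rewrite n0 muln0.
  have qWi := subsetP (nb_sub _ _ _) _ qW.
  have qG := subsetP sWi _ qWi.
  have hyq : h y q by move: qW; rewrite in_set => /andP[].
  apply: (@no_house _ e es ei P5 a y y' b q) => //.
  - exact: haW.
  - by rewrite hsym.
  - by rewrite hsym.
  - by rewrite hsym; apply: haW.
  - by rewrite hsym.
  - by apply: heN => //; apply: neG ne aG y'G.
  - by apply: heN; [apply: neG ne yG bG | rewrite hsym; apply: nby].
  - by apply: heN => //; apply: neG ne qG y'G.
  - by apply: heN => //; apply: neG ne qG bG.
have exL (i : 'I_(t ^ 3)) : exists L : {set T}, i \in I ->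
    [/\ L \subset C' i, conn h L & lg t 336 #|A| #|L|].
  case: (boolP (i \in I)) => [iI|_]; last by exists set0.
  have lC := lgt (lgt (lW i iI) (lg1 t2 (cW i iI))) (lg1 t2 (cC i iI)).
  have [|L [sL cL _ lL]] := large_cmp _ (lgw t2 lC isT).
    by apply: subset_trans (sC' i) (subset_trans (sC i) (sWA i iI)).
  by exists L => _; split=> //; apply: (lgw t2 (lgt lC lL) isT).
have [L HL] := fin_all_exists exL.
have sLA i : i \in I -> L i \subset A.
  move=> iI; have [sL _ _] := HL i iI.
  by apply: subset_trans sL (subset_trans (sC' i) (subset_trans (sC i) (sWA i iI))).
have HL' i : i \in I -> #|M| <= 2 * t * #|mix M (L i)|.
  by move=> iI; have [_ _ lL] := HL i iI; apply: mixA (sLA i iI) lL.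
have := count_disj HL'; rewrite leq_pmul2r // => leI.
have {}leI : #|I| <= 2 * t.
  apply: leI => u i l uM iI lI ui ul; apply: contraTeq isT => ne.
  have {}ui : u \in mix M (L i) by rewrite inE uM.
  have {}ul : u \in mix M (L l) by rewrite inE uM.
  have [sL cL _] := HL i iI; have [sL' cL' _] := HL l lI.
  case: (@mix_disj_anti (L i) (L l) u) => //; try exact: sLA.
  exact: anti_sub sL sL' (antiC i l iI lI ne).
move: bigI leI t64; move: #|I| => n; rewrite !expnS expn0 muln1; clear; nia.
Qed.

End Sparse.

Lemma hub_contradiction : False.
Proof.
case: (classic (exists A' : {set T}, [/\ A' \subset A, #|A| <= 2 * #|A'| &
  forall J, J \subset A' -> lg t 190 #|A| #|J| -> t ^ 16 * #|J| <= #|A| ->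
    lg t 4 #|A| #|[set u in A' | lg t 120 #|J| #|nb h u J|]|])) => [[A' [sA' hA' dA']]|no].
  exact: dense_case_false sA' hA' dA'.
apply: sparse_case_false => A' sA' hA'; apply: NNPP => no2; apply: no; exists A'; split=> //.
move=> J sJ lJ smJ; rewrite lgE leqNgt; apply/negP=> lt; apply: no2; exists J; split=> //.
Qed.

End FixedDensity.

(** * Squaring the density or finding a pure blockade *)

Definition blockade (T : finType) (e : rel T) (G : {set T}) k w :=
  exists F : nat -> {set T}, (forall i, i < k -> F i \subset G /\ w <= #|F i|) /\
    ((forall i j, i < j -> j < k -> anti e (F i) (F j)) \/
     (forall i j, i < j -> j < k -> anti (compl_rel e) (F i) (F j))).

(* Quotients by [#|B|] become natural numbers after multiplication by [#|T|`!]. *)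
Lemma min_ratio (T : finType) (Q : pred {set T}) (a : {set T} -> nat) V :
  Q V -> (forall B, Q B -> 0 < #|B|) ->
  exists2 A, Q A & forall B, Q B -> a A * #|B| <= a B * #|A|.
Proof.
move=> QV Q0; pose K := #|T|`!.
pose wt (B : {set T}) := a B * (K %/ #|B|).
case: (arg_minnP wt QV) => A QA minA; exists A => // B QB.
have Kd (B' : {set T}) : Q B' -> K %/ #|B'| * #|B'| = K.
  by move=> QB'; rewrite divnK // dvdn_fact // Q0 //= max_card.
have K0 : 0 < K := fact_gt0 _.
rewrite -(leq_pmul2r K0); have := minA B QB; rewrite /wt; move: (Kd _ QA) (Kd _ QB) K0.
move: (K %/ #|A|) (K %/ #|B|) => x y E1 E2 K0 le.
rewrite -[in X in X <= _]E1 -[in X in _ <= X]E2.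
by have := leq_mul le (leqnn (#|A| * #|B|)); lia.
Qed.

Lemma sum_disj (T I : finType) (Q : {set I}) (M : {set T}) (P : I -> T -> bool) :
  (forall w i j, w \in M -> i \in Q -> j \in Q -> P i w -> P j w -> i = j) ->
  \sum_(i in Q) #|[set w in M | P i w]| <= #|M|.
Proof.
move=> inj; rewrite sum_card_exchange -sum1_card; apply: leq_sum => w wM.
rewrite leqNgt; apply/negP=> /card_gt1P[i [j [/setIdP[Hi Pi] /setIdP[Hj Pj]]]].
by rewrite (inj w i j) ?eqxx.
Qed.

Section SquareDensity.
Variables (T : finType) (e : rel T).
Hypotheses (es : symmetric e) (ei : irreflexive e) (P5 : P5_free e).
Notation h := (compl_rel e).
Implicit Types (A B D J L X Z : {set T}).
Variables (t0 c1 c3 g C D0 p Y : nat) (G : {set T}).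
Hypotheses (t064 : 64 <= t0) (c21 : 21 <= c1) (Ec3 : c3 = c1 + 21) (Eg : g = 16 * c3)
  (EC : C = 4 * c3 + 5) (p64 : 64 <= p).
Hypotheses (Y1 : 2 * (8 * p) ^ g <= Y) (Y2 : 32 * p <= Y)
  (Y3 : forall t, t ^ 16 < Y ^ 2 -> 16 * p * t <= Y) (Y4 : t0 ^ 16 < Y ^ 2).
Hypothesis D0le : D0 <= t0 ^ (16 * c1).
Hypothesis rodl : forall S : {set T},
  exists X, [/\ X \subset S, #|S| <= D0 * #|X| & sp e (t0 ^ 16) X \/ sp h (t0 ^ 16) X].
Notation n := #|G|.
Hypothesis spG : sp h Y G.
Hypothesis nosp : forall A, A \subset G -> sp h (Y ^ 2) A -> ~ n <= Y ^ C * #|A|.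
Hypothesis noblock : forall w, n <= Y ^ C * w -> ~ blockade e G p w.

Let hs := hsym es.
Let g_2 : exists2 k, g = k.+2 & 2 * g <= 4 * k.+1.
Proof. by exists g.-2; clear -c21 Ec3 Eg; lia. Qed.
Let g0 : 0 < g. Proof. by case: g_2 => k ->. Qed.
Let Yp i : 0 < Y ^ i. Proof. by rewrite expn_gt0; apply/orP; left; lia. Qed.
Let YX i j : i <= j -> Y ^ i <= Y ^ j.
Proof. by move=> le; rewrite leq_pexp2l //; lia. Qed.

Lemma n_big : Y ^ C < n.
Proof.
have n0 : 0 < n.
  rewrite lt0n; apply/negP=> /eqP E; case: (@nosp set0); rewrite ?sub0set ?E //.
  exact: sp_set0.
have /card_gt0P[x xG] := n0.
rewrite ltnNge; apply/negP=> le; case: (@nosp [set x]).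
- by rewrite sub1set.
- exact: sp_set1 (h_irr e).
- by rewrite cards1 muln1.
Qed.

Lemma nbG x X : x \in G -> X \subset G -> Y * #|nb h x X| <= n.
Proof.
move=> xG sX; apply: leq_trans (spG xG); rewrite leq_mul2l.
by rewrite subset_leq_card ?orbT // nb_mono.
Qed.

Lemma tau_ex : exists tau, [/\ 0 < tau, n <= Y ^ C * tau, Y ^ C * tau <= 2 * n &
  forall x, n <= Y ^ C * x -> tau <= x].
Proof.
have ex : exists x, n <= Y ^ C * x by exists n; apply: leq_pmull.
case: (ex_minnP ex) => tau le min; have nb := n_big.
have tau0 : 0 < tau by rewrite lt0n; apply: contraTneq le => ->; rewrite muln0 -ltnNge; lia.
exists tau; split=> //; rewrite leqNgt; apply/negP=> lt.
have /min : n <= Y ^ C * tau.-1 by rewrite -subn1 mulnBr muln1; lia.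
lia.
Qed.

Lemma expanding_subset : exists S : {set T}, [/\ S \subset G, n <= 2 * #|S| &
  forall J, J \subset S -> n <= Y ^ C * #|J| ->
    n <= 4 * p * #|[set x in S | [exists j in J, h x j]]|].
Proof.
apply: NNPP => no.
have [tau [tau0 tau1 tau2 tau3]] := tau_ex.
apply: (noblock tau1).
pose R J (x : T) := (x \notin J) && [forall j in J, ~~ h x j].
have pp : 0 < 4 * p by lia.
have [||F [F1 F2]] := @greedy T (fun J => tau <= #|J|) R G (tau + n %/ (4 * p)) _ p.
- move=> Z sZ cZ; apply: NNPP => no2; apply: no; exists Z; split=> // J sJ cJ.
  rewrite leqNgt; apply/negP=> lt; apply: no2.
  have [J' sJ' cJ'] := trim (tau3 _ cJ).
  exists J'; split; rewrite ?cJ' //; first exact: subset_trans sJ.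
  have sub : Z \subset [set x in Z | R J' x] :|: (J' :|: [set x in Z | [exists j in J, h x j]]).
    apply/subsetP=> z zZ; rewrite !inE zZ /R; case: (z \in J'); rewrite ?orbT //=.
    case: (boolP [exists j in J, h z j]); rewrite ?orbT // negb_exists_in orbF.
    by move=> /forall_inP H; apply/forall_inP=> j /(subsetP sJ')/H.
  have := subset_leq_card sub; have := leq_card_setU [set x in Z | R J' x] (J' :|: [set x in Z | [exists j in J, h x j]]).
  have := leq_card_setU J' [set x in Z | [exists j in J, h x j]]; rewrite cJ'.
  have : #|[set x in Z | [exists j in J, h x j]]| <= n %/ (4 * p).
    by rewrite leq_divRL // mulnC ltnW.
  clear; move: (_ %/ _) => c l1 [l2 _] [l3 _]; lia.
- have le8 : 8 * p <= Y ^ C by apply: (@leq_trans (Y ^ 1)); [rewrite expn1; lia | apply: YX; lia].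
  have : 8 * p * tau <= 2 * n by apply: leq_trans tau2; rewrite leq_mul2r le8 orbT.
  have := leq_trunc_div n (4 * p); clear; move: (_ %/ _) => c; lia.
exists F; split; first exact: F1.
right=> i j ltij ltj a b aF bF.
have /andP[bn /forall_inP/(_ a aF)] := F2 i j b ltij ltj bF.
by rewrite hs; split=> //; apply: contraNneq bn => <-.
Qed.

Section Hub.
Variables (A0 M : {set T}) (v : T).
Let fs B := [set w in M | [exists b in B, h w b]].
Hypotheses (sA0 : A0 \subset G) (sM : M \subset G).
Hypothesis hubA : forall a, a \in A0 -> h v a.
Hypothesis hubM : forall w, w \in M -> e v w.
Hypothesis A0big : n <= Y ^ 3 * #|A0|.
Hypothesis fbig : forall B, B \subset A0 -> n <= Y ^ C * #|B| -> n <= 8 * p * #|fs B|.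
(* [A0] minimises [#|fs B| ^ g / #|B|] over the large [B]: much smaller subsets of [A0] still
   have almost as many neighbours in [M]. *)
Hypothesis ratio : forall B, B \subset A0 -> n <= Y ^ C * #|B| ->
  #|M| ^ g * #|B| <= #|fs B| ^ g * #|A0|.

Lemma pow_g t : t ^ 16 < Y ^ 2 -> t ^ g <= Y ^ (2 * c3).
Proof.
move=> lt; rewrite Eg [t ^ _]expnM [Y ^ _]expnM.
have c30 : 0 < c3 by lia.
by rewrite leq_exp2r // ltnW.
Qed.

Lemma big_enough t B : t ^ 16 < Y ^ 2 -> #|A0| <= t ^ g * #|B| ->
  n <= Y ^ (3 + 2 * c3) * #|B|.
Proof.
move=> lt le; apply: leq_trans A0big _; rewrite expnD -mulnA leq_mul2l; apply/orP; right.
by apply: leq_trans le _; rewrite leq_mul2r pow_g ?orbT.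
Qed.

Lemma big_enoughC t B : t ^ 16 < Y ^ 2 -> #|A0| <= t ^ g * #|B| -> n <= Y ^ C * #|B|.
Proof.
move=> lt le; apply: leq_trans (big_enough lt le) _; rewrite leq_mul2r YX ?orbT //; lia.
Qed.

Lemma fs_mix B b : B \subset A0 -> b \in B -> Y * #|fs B| <= Y * #|mix e M B| + n.
Proof.
move=> sB bB; have bG : b \in G by apply: (subsetP sA0); apply: (subsetP sB).
have sub : fs B \subset mix e M B :|: nb h b M.
  apply/subsetP=> w /setIdP[wM ex]; apply/setUP.
  case: (boolP (h b w)) => [hb|nh]; first by right; apply/setIdP.
  by left; rewrite in_set wM ex /=; apply/exists_inP; exists b => //; rewrite hs.
have := nbG bG sM; have := subset_leq_card sub.
have := leq_card_setU (mix e M B) (nb h b M).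
move=> [le _] le2 le3; apply: leq_trans (_ : Y * (#|mix e M B| + #|nb h b M|) <= _).
  by rewrite leq_mul2l (leq_trans le2) ?orbT.
by rewrite mulnDr leq_add2l.
Qed.

Lemma ex_in B : n <= Y ^ C * #|B| -> exists b, b \in B.
Proof.
move=> le; apply/set0Pn; apply: contraTneq le => ->; rewrite cards0 muln0 -ltnNge.
by have := n_big; lia.
Qed.

Lemma n_leM : n <= 8 * p * #|M|.
Proof.
have le : n <= Y ^ C * #|A0|.
  by apply: leq_trans A0big _; rewrite leq_mul2r YX ?orbT //; lia.
apply: leq_trans (fbig (subxx _) le) _; rewrite leq_mul2l; apply/orP; right.
by apply/subset_leq_card/subsetP=> w /setIdP[].
Qed.

Lemma mix_hub t B : t ^ 16 < Y ^ 2 -> B \subset A0 -> #|A0| <= t ^ g * #|B| ->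
  #|M| <= 2 * t * #|mix e M B|.
Proof.
move=> lt sB leB; have leC := big_enoughC lt leB.
have [b bB] := ex_in leC.
have lef : #|M| <= t * #|fs B|.
  have B0 : 0 < #|B| by apply/card_gt0P; exists b.
  rewrite -(leq_exp2r _ _ g0) -(leq_pmul2r B0) expnMn; apply: leq_trans (ratio sB leC) _.
  move: leB; move: (t ^ g) (#|fs B| ^ g) #|A0| #|B| => x y a b'; clear=> leB.
  by have := leq_mul (leqnn y) leB; lia.
have := fs_mix sB bB; have := n_leM; have := Y3 lt; have := Yp 1; rewrite expn1.
move: lef; move: #|M| #|fs B| #|mix e M B| => m f x; clear.
move=> lef Y0 lt le1 le2; rewrite -(leq_pmul2l Y0).
have : Y * m <= t * (Y * x + n).
  by apply: (@leq_trans (t * (Y * f))); [rewrite mulnCA leq_mul2l lef orbT | rewrite leq_mul2l le2 orbT].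
have : 2 * (t * n) <= Y * m.
  apply: (@leq_trans (2 * (t * (8 * p * m)))); first by rewrite !leq_mul2l le1 !orbT.
  by have := leq_mul lt (leqnn m); lia.
by rewrite mulnDr; lia.
Qed.

Lemma comp_hub t X : 64 <= t -> t ^ 16 < Y ^ 2 -> X \subset A0 -> #|A0| <= t ^ g * #|X| ->
  exists D, [/\ D \subset X, conn e D, anti e D (X :\: D) & #|X| <= t ^ 4 * #|D|].
Proof.
move=> t64 lt sX leX.
case: (boolP [exists x in X, #|X| <= t ^ 4 * #|cmp e X x|]).
  case/exists_inP=> x xX le; exists (cmp e X x).
  by split=> //; [apply: cmp_sub | apply: cmp_conn | apply: cmp_anti].
rewrite negb_exists_in => /forall_inP no; exfalso.
have [tau [tau0 tau1 tau2 tau3]] := tau_ex.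
have nX := big_enough lt leX.
pose Xt := [set x in X | #|cmp e X x| < tau].
have sXt : Xt \subset X by apply/subsetP=> x /setIdP[].
case: (leqP #|X| (2 * #|Xt|)) => [leT|ltB].
  case: (noblock tau1).
  have [||F [F1 F2]] := @group T e Xt tau p es tau0.
  - move=> x xXt; have := xXt; rewrite in_set => /andP[xX]; apply: leq_ltn_trans.
    apply/subset_leq_card/conn_sub_cmp => //; last exact: cmp_self.
      exact: subset_trans (cmp_sub _ _ _) sXt.
    exact: cmp_conn.
  - have : Y ^ C * (8 * (p * tau)) <= Y ^ C * #|X|.
      have YC : Y ^ C = Y * Y ^ C.-1 by rewrite -expnS prednK //; lia.
      apply: (@leq_trans (16 * p * n)).
        have := leq_mul (leqnn (8 * p)) tau2; clear; move: (Y ^ C) => K; lia.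
      apply: (@leq_trans (Y * n)); first by rewrite leq_mul2r; apply/orP; right; lia.
      rewrite YC -mulnA leq_mul2l; apply/orP; right; apply: leq_trans nX _.
      by rewrite leq_mul2r YX ?orbT //; lia.
    by rewrite leq_pmul2l ?Yp //; lia.
  exists F; split; last by left.
  by move=> i lti; have [s1 s2] := F1 i lti; split=> //; apply: subset_trans s1 (subset_trans sXt (subset_trans sX sA0)).
set Xb := X :\: Xt.
have cX := cardsID Xt X; rewrite (setIidPr sXt) -/Xb in cX.
have bigX : #|X| <= 2 * #|Xb| by lia.
pose Q := [set cmp e X x | x in Xb].
have HQ D : D \in Q -> exists2 x, x \in X & D = cmp e X x /\ tau <= #|D|.
  case/imsetP=> x; rewrite in_setD in_set negb_and -leqNgt => /andP[/orP[/negP//|le] xX] ->.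
  by exists x.
have sumD : #|Xb| <= \sum_(D in Q) #|D|.
  have : Xb \subset \bigcup_(D in Q) D.
    apply/subsetP=> x xb; apply/bigcupP; exists (cmp e X x); first exact: imset_f.
    by apply: cmp_self; move: xb; rewrite in_setD => /andP[].
  move/subset_leq_card => le; apply: leq_trans le _.
  apply: (big_rec2 (fun (U : {set T}) k => #|U| <= k)); first by rewrite cards0.
  move=> D k U _ le; apply: leq_trans (leq_card_setU _ _).1 _; lia.
have sumM : \sum_(D in Q) #|mix e M D| <= #|M|.
  apply: (@sum_disj T _ Q M (fun D w => [exists b in D, h w b] && [exists b in D, ~~ h w b])).
  move=> w D D' wM /HQ[x xX [ED _]] /HQ[y yX [ED' _]] m1 m2.
  apply: contraTeq isT => ne.
  case: (@mix_disj_compl _ e es ei P5 A0 M v hubA hubM D D' w) => //.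
  - by rewrite ED; apply: subset_trans (cmp_sub _ _ _) sX.
  - by rewrite ED'; apply: subset_trans (cmp_sub _ _ _) sX.
  - by rewrite ED; apply: cmp_conn.
  - by rewrite ED'; apply: cmp_conn.
  - rewrite ED; apply: anti_sub (subxx _) _ (@cmp_anti _ e X x); apply/subsetP=> z zD'.
    have zX : z \in X by apply: (subsetP (cmp_sub e X y)); rewrite -ED'.
    rewrite in_setD zX andbT; apply: contra ne => zD.
    by rewrite ED ED' -(cmp_eq es zD) (cmp_eq (y := z) (x := y) es) // -ED'.
  - by rewrite inE wM.
  - by rewrite inE wM.
have HD D : D \in Q -> t * #|M| * #|D| <= 2 * #|X| * #|mix e M D|.
  move=> /HQ[x xX [ED leD]].
  have sDX : D \subset X by rewrite ED; apply: cmp_sub.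
  have sD : D \subset A0 := subset_trans sDX sX.
  have leC : n <= Y ^ C * #|D| by apply: leq_trans tau1 _; rewrite leq_mul2l leD orbT.
  have [b bD] := ex_in leC.
  have D0' : 0 < #|D| by apply/card_gt0P; exists b.
  have fm : #|fs D| <= 2 * #|mix e M D|.
    have := fs_mix sD bD; have := fbig sD leC; have := Yp 1; rewrite expn1; move: Y2.
    move: #|fs D| #|mix e M D| => f m; clear => Y2 Y0 le1 le2; rewrite -(leq_pmul2l Y0).
    have := leq_mul Y2 (leqnn f); lia.
  have [k gk leg] := g_2; have gE : g = g.-1.+1 by rewrite gk.
  have key : t * #|M| * #|D| <= #|fs D| * #|X|.
        rewrite -(leq_exp2r _ _ g0) !expnMn.
    have smD : t ^ 4 * #|D| <= #|X| by rewrite ltnW // ltnNge; move: (no x xX); rewrite ED.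
    have le1 := ratio sD leC.
    have le2 : t ^ (2 * g) * #|D| ^ g.-1 <= #|X| ^ g.-1.
      have g10 : 0 < g.-1 by rewrite gk.
      apply: (@leq_trans ((t ^ 4 * #|D|) ^ g.-1)); last by rewrite leq_exp2r.
      rewrite expnMn -expnM leq_mul2r leq_pexp2l ?orbT //; first by clear -t64; lia.
      by rewrite [in X in _ <= X]gk.
    have ED1 : #|D| ^ g = #|D| * #|D| ^ g.-1 by rewrite [in LHS]gE expnS.
    have EX1 : #|X| ^ g = #|X| * #|X| ^ g.-1 by rewrite [in LHS]gE expnS.
    have Et : t ^ (2 * g) = t ^ g * t ^ g by rewrite mul2n -addnn expnD.
    rewrite ED1 EX1.
    apply: (@leq_trans (t ^ g * #|D| ^ g.-1 * (#|fs D| ^ g * #|A0|))).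
      by have := leq_mul (leqnn (t ^ g * #|D| ^ g.-1)) le1; clear; lia.
    apply: (@leq_trans (t ^ g * #|D| ^ g.-1 * (#|fs D| ^ g * (t ^ g * #|X|)))).
      by rewrite !leq_mul2l leX !orbT.
    by have := leq_mul (leqnn (#|fs D| ^ g * #|X|)) le2; rewrite Et; clear; lia.
  by apply: leq_trans key _; have := leq_mul fm (leqnn #|X|); clear; lia.
have : t * #|M| * (\sum_(D in Q) #|D|) <= 2 * #|X| * (\sum_(D in Q) #|mix e M D|).
  by rewrite !big_distrr; apply: leq_sum.
have nn := n_big; have nM := n_leM.
have X0 : 0 < #|X| by rewrite lt0n; apply: contraTneq nX => ->; rewrite muln0 -ltnNge; lia.
have M0 : 0 < #|M| by rewrite lt0n; apply: contraTneq nM => ->; rewrite muln0 -ltnNge; lia.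
move: sumD sumM bigX t64 X0 M0; clear.
move: (\sum_(D in Q) _) (\sum_(D in Q) _) #|X| #|M| #|Xb| => k d x m b.
move=> le1 le2 le3 t64 x0 m0 le4.
have : t * m * x <= 2 * (2 * x * m).
  apply: (@leq_trans (t * m * (2 * d))); first by rewrite leq_mul2l (leq_trans le3) ?orbT // leq_mul2l le1 orbT.
  apply: (@leq_trans (2 * (t * m * d))); first by lia.
  by rewrite leq_mul2l /= (leq_trans le4) // leq_mul2l le2 orbT.
have xm0 : 0 < x * m by rewrite muln_gt0 x0.
have := leq_mul t64 (leqnn (x * m)); lia.
Qed.

Let chain_inv t A := [/\ A \subset A0, sp h (t ^ 16) A & #|A0| <= t ^ (16 * c1) * #|A|].

Let g_c1 : g = 16 * c1 + 336. Proof. by clear -Ec3 Eg; lia. Qed.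

Lemma chain_inv_g t i A B : 64 <= t -> i <= 336 -> #|A0| <= t ^ (16 * c1) * #|A| ->
  lg t i #|A| #|B| -> #|A0| <= t ^ g * #|B|.
Proof.
move=> t64 le leA leB; have t2 : 2 <= t by apply: leq_trans t64.
have l1 : lg t (16 * c1) #|A0| #|A| by rewrite lgE.
by rewrite -lgE; apply: (lgw t2 (lgt l1 leB)); rewrite g_c1 leq_add2l.
Qed.

Lemma chain_inv_step t A : 64 <= t -> t ^ 16 < Y ^ 2 -> chain_inv t A -> exists B, chain_inv (t ^ 2) B.
Proof.
move=> t64 lt [sA spA leA]; apply: NNPP => no.
have t2 : 2 <= t by apply: leq_trans t64.
have M0 : 0 < #|M|.
  by rewrite lt0n; apply: contraTneq n_leM => ->; rewrite muln0 -ltnNge; have := n_big; lia.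
apply: (@hub_contradiction T e es ei P5 t A M v t64 _ hubM M0 spA).
- by move=> a aA; apply: hubA; apply: (subsetP sA).
- move=> B sB spB leB; apply: no; exists B; split.
  + exact: subset_trans sB sA.
  + by rewrite -expnM (_ : 2 * 16 = 32).
  + have l1 : lg t (16 * c1) #|A0| #|A| by rewrite lgE.
    by rewrite -expnM -lgE; apply: (lgw t2 (lgt l1 leB)); clear -c21; lia.
- move=> B sB leB; apply: mix_hub => //; first exact: subset_trans sB sA.
  exact: chain_inv_g leB.
- move=> X sX leX; have [||D [D1 D2 D3 D4]] := @comp_hub t X t64 lt.
  + exact: subset_trans sX sA.
  + exact: chain_inv_g leX.
  by exists D; split; rewrite ?lgE.
Qed.

Lemma chain_inv_false t A : 64 <= t -> t ^ 16 < Y ^ 2 -> chain_inv t A -> False.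
Proof.
have [s] : exists s, Y ^ 2 <= t ^ 16 + s by exists (Y ^ 2); apply: leq_addl.
elim: s t A => [|s IH] t A les t64 lt iA.
  by move: les; rewrite addn0 leqNgt lt.
have [B iB] := chain_inv_step t64 lt iA.
have tt : t < t ^ 2 by rewrite -[X in X < _]expn1 ltn_exp2l //; apply: leq_trans t64.
have [lt2|le2] := ltnP ((t ^ 2) ^ 16) (Y ^ 2).
  apply: IH lt2 iB; last by apply: leq_trans t64 (ltnW tt).
  apply: leq_trans les _; rewrite -addSnnS leq_add2r.
  by rewrite ltn_exp2r.
have [sB spB leB] := iB.
case: (@nosp B); first exact: subset_trans sB sA0.
  exact: sp_weak le2 spB.
apply: leq_trans A0big _; apply: (@leq_trans (Y ^ (3 + 4 * c1) * #|B|)).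
  rewrite expnD -mulnA leq_mul2l; apply/orP; right; apply: leq_trans leB _.
  rewrite leq_mul2r; apply/orP; right.
  have -> : (t ^ 2) ^ (16 * c1) = (t ^ 16) ^ (2 * c1) by rewrite -!expnM; congr (_ ^ _); lia.
  have -> : Y ^ (4 * c1) = (Y ^ 2) ^ (2 * c1) by rewrite -!expnM; congr (_ ^ _); lia.
  by rewrite leq_exp2r; [apply: ltnW | clear -c21; lia].
by rewrite leq_mul2r YX ?orbT //; clear -Ec3 EC; lia.
Qed.

Lemma hub_false : False.
Proof.
have [X [sX leX spX]] := rodl A0.
have {}leX : #|A0| <= t0 ^ (16 * c1) * #|X|.
  by apply: leq_trans leX _; rewrite leq_mul2r D0le orbT.
case: spX => spX; last by apply: (@chain_inv_false t0 X).
apply: (@gyarfas _ e es ei P5 X t0) => //; first by apply: leq_trans t064.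
  have lg0 : lg t0 0 #|X| #|X| by rewrite lgE expn0 mul1n.
  have := big_enough Y4 (chain_inv_g t064 (leq0n _) leX lg0).
  move=> le; rewrite leqNgt; apply/negP=> lt.
  have : n <= Y ^ C.
    apply: leq_trans le _; have -> : C = 3 + 2 * c3 + (1 + 2 + (2 * c3 - 1)) by clear -EC c21 Ec3; lia.
    rewrite [Y ^ (_ + (_ + _))]expnD leq_mul2l; apply/orP; right.
    apply: (@leq_trans (Y ^ (1 + 2))); last by rewrite YX // leq_addr.
    apply: leq_trans (ltnW lt) _; rewrite expnD expn1; apply: leq_mul; last exact: ltnW.
    by clear -Y2 p64; lia.
  by rewrite leqNgt n_big.
move=> X' sX' leX'; apply: comp_hub => //; first exact: subset_trans sX' sX.
have l1 : lg t0 13 #|X| #|X'| by rewrite lgE.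
exact: chain_inv_g l1.
Qed.

End Hub.

Lemma no_stuck_sparse_set : False.
Proof.
have [S [sS cS expS]] := expanding_subset.
have [x xS bigx] : exists2 x, x \in S & #|S| < Y ^ 2 * #|nb h x S|.
  apply: NNPP => no; case: (@nosp S) => //.
    by move=> x xS; rewrite leqNgt; apply/negP=> lt; apply: no; exists x.
  apply: leq_trans cS _; rewrite leq_mul2r; apply/orP; right.
  by apply: (@leq_trans (Y ^ 1)); [rewrite expn1; clear -Y2 p64; lia | apply: YX; clear -EC; lia].
set V := nb h x S in bigx.
have xG := subsetP sS _ xS.
have sVS : V \subset S := nb_sub _ _ _.
pose M0 := [set w in S | (w != x) && ~~ h x w].
pose fs (B : {set T}) := [set w in M0 | [exists b in B, h w b]].
have nV : n <= 2 * Y ^ 2 * #|V|.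
  by apply: leq_trans cS _; rewrite -mulnA leq_mul2l (ltnW bigx).
have Yp2 : 2 <= Y by clear -Y2 p64; lia.
have V3 : n <= Y ^ 3 * #|V|.
  by apply: leq_trans nV _; rewrite expnS leq_mul2r leq_mul2r Yp2 !orbT.
have fbig B : B \subset V -> n <= Y ^ C * #|B| -> n <= 8 * p * #|fs B|.
  move=> sB leB; have := expS B (subset_trans sB sVS) leB.
  set N := [set _ in S | _] => leN.
  have sub : N \subset fs B :|: (nb h x G :|: [set x]).
    apply/subsetP=> w /setIdP[wS ex]; apply/setUP.
    have [wx|wx] := eqVneq w x; first by right; rewrite wx in_setU set11 orbT.
    case: (boolP (h x w)) => [hw|nh]; first by right; apply/setUP; left; apply/setIdP; rewrite (subsetP sS).
    by left; apply/setIdP; split=> //; apply/setIdP; rewrite wx.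
  have := subset_leq_card sub; have := leq_card_setU (fs B) (nb h x G :|: [set x]).
  have := leq_card_setU (nb h x G) [set x]; rewrite cards1.
  have nY : Y <= n.
    apply: leq_trans (ltnW n_big); apply: (@leq_trans (Y ^ 1)); first by rewrite expn1.
    by apply: YX; clear -EC; lia.
  have := spG xG; move: leN nY Y2; move: #|N| #|fs B| #|_ :|: [set x]| #|nb h x G| #|fs B :|: _|.
  move=> a b c d f; clear => le1 le2 le3 le4 [le5 _] [le6 _] le7.
  have : 32 * p * d <= n by apply: leq_trans le4; rewrite leq_mul2r le3 orbT.
  have : n <= 4 * p * (b + (d + 1)).
    by apply: leq_trans le1 _; rewrite leq_mul2l; apply/orP; right; lia.
  lia.
pose Q (B : {set T}) := (B \subset V) && (n <= Y ^ C * #|B|).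
have QV : Q V.
  by rewrite /Q subxx (leq_trans V3) // leq_mul2r YX ?orbT //; clear -EC; lia.
have Q0 B : Q B -> 0 < #|B|.
  case/andP=> _ le; rewrite lt0n; apply: contraTneq le => ->; rewrite muln0 -ltnNge.
  by have := n_big; lia.
have [A /andP[sA cA] minA] := min_ratio (fun B => #|fs B| ^ g) QV Q0.
have sM : fs A \subset G.
  by apply: subset_trans sS; apply/subsetP=> w /setIdP[/setIdP[]].
apply: (@hub_false A (fs A) x).
- exact: subset_trans sA (subset_trans sVS sS).
- exact: sM.
- by move=> a /(subsetP sA); rewrite inE => /andP[].
- move=> w /setIdP[/setIdP[wS /andP[wx nh]] _]; apply: heN => //.
  by rewrite eq_sym.
- have := minA V QV; have := fbig A sA cA.
  have fVn : #|fs V| <= n.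
    by apply/subset_leq_card; apply: subset_trans sS; apply/subsetP=> w /setIdP[/setIdP[]].
  move=> le1 le2.
  have n0 : 0 < n ^ g by rewrite expn_gt0; have := n_big; lia.
  have le3 : n ^ g <= (8 * p) ^ g * #|fs A| ^ g by rewrite -expnMn leq_exp2r.
  have le4 : #|fs V| ^ g <= n ^ g by rewrite leq_exp2r.
  have le5 : #|V| <= (8 * p) ^ g * #|A|.
    rewrite -(leq_pmul2l n0); apply: (@leq_trans ((8 * p) ^ g * #|fs A| ^ g * #|V|)).
      by rewrite leq_mul2r le3 orbT.
    rewrite -mulnA (mulnCA (n ^ g)) leq_mul2l; apply/orP; right.
    by apply: leq_trans le2 _; rewrite leq_mul2r le4 orbT.
  apply: leq_trans nV _; rewrite [Y ^ 3]expnSr.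
  have := leq_mul (leqnn (2 * Y ^ 2)) le5; have := leq_mul Y1 (leqnn (Y ^ 2 * #|A|)).
  by clear; lia.
- move=> B sB leB; apply: leq_trans (fbig B (subset_trans sB sA) leB) _.
  rewrite leq_mul2l; apply/orP; right; apply/subset_leq_card/subsetP=> w /setIdP[wM ex].
  apply/setIdP; split=> //; apply/setIdP; split=> //.
  by case/exists_inP: ex => b bB hb; apply/exists_inP; exists b => //; apply: (subsetP sB).
- move=> B sB leB.
  rewrite (_ : [set w in fs A | _] = fs B).
    by apply: minA; rewrite /Q leB (subset_trans sB sA).
  apply/setP=> w; apply/setIdP/setIdP => [[/setIdP[wM _] ex]|[wM ex]]; split=> //.
  apply/setIdP; split=> //.
  by case/exists_inP: ex => b bB hb; apply/exists_inP; exists b => //; apply: (subsetP sB).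
Qed.

End SquareDensity.

(** * Combining blockades *)

Lemma leq_expl a b i : a <= b -> a ^ i <= b ^ i.
Proof. by case: i => [|i] le; rewrite ?expn0 // leq_exp2r. Qed.

Lemma bounded_choice (A : Type) (x0 : A) (P : nat -> A -> Prop) k :
  (forall i, i < k -> exists x, P i x) -> exists f : nat -> A, forall i, i < k -> P i (f i).
Proof.
elim: k => [|k IH] H; first by exists (fun=> x0).
have [|f Hf] := IH; first by move=> i lti; apply: H; apply: ltnW.
have [x Hx] := H k (leqnn _).
exists (fun i => if i == k then x else f i) => i; case: eqP => [-> //|/eqP ne].
by rewrite ltnS leq_eqVlt (negbTE ne) => /Hf.
Qed.

Section CombineBlockades.
Variables (T : finType) (e : rel T) (N d : nat).
Hypotheses (es : symmetric e) (ei : irreflexive e) (N2 : 2 <= N).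
Notation h := (compl_rel e).
Implicit Types (S B X : {set T}).

Definition anti_family (r : rel T) S k w (F : nat -> {set T}) :=
  (forall i, i < k -> F i \subset S /\ w <= #|F i|) /\
  (forall i j, i < j -> j < k -> anti r (F i) (F j)).

Lemma anti_family_single r S w : w <= #|S| -> exists F, anti_family r S 1 w F.
Proof.
move=> le; exists (fun=> S); split; first by move=> i _; rewrite subxx.
by move=> i [].
Qed.

Lemma anti_family_weak r S S' k k' w F : S \subset S' -> k' <= k -> anti_family r S k w F -> anti_family r S' k' w F.
Proof.
move=> sS lek [F1 F2]; split.
  by move=> i lti; have [s c] := F1 i (leq_trans lti lek); split=> //; apply: subset_trans sS.
by move=> i j ltij ltj; apply: F2 ltij (leq_trans ltj lek).
Qed.

Lemma anti_family_prod r S k a w w' (F : nat -> {set T}) (H : nat -> nat -> {set T}) : 0 < a ->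
  anti_family r S k w' F -> (forall i, i < k -> anti_family r (F i) a w (H i)) ->
  anti_family r S (k * a) w (fun x => H (x %/ a) (x %% a)).
Proof.
move=> a0 [F1 F2] HH.
have lt x : x < k * a -> x %/ a < k /\ x %% a < a by move=> ltx; rewrite ltn_divLR // ltn_mod.
split=> [i /lt[lt1 lt2]|i j ltij /lt[lt1 lt2]].
  have [s c] := (HH _ lt1).1 _ lt2; split=> //; exact: subset_trans s (F1 _ lt1).1.
have ltia : i %% a < a by rewrite ltn_mod.
have := leq_div2r a (ltnW ltij); rewrite leq_eqVlt => /orP[/eqP E|ltd].
  rewrite E; apply: (HH _ lt1).2 => //.
  by move: ltij; rewrite {1}(divn_eq i a) {1}(divn_eq j a) E ltn_add2l.
have ltik := ltn_trans ltd lt1.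
exact: anti_sub ((HH _ ltik).1 _ ltia).1 ((HH _ lt1).1 _ lt2).1 (F2 _ _ ltd lt1).
Qed.

Lemma anti_family_sp r S k w F : 0 < k -> 0 < w -> irreflexive r -> symmetric r -> anti_family r S k w F ->
  exists X, [/\ X \subset S, w <= #|X| & sp r k X].
Proof.
move=> k0 w0 ri rs [F1 F2].
have exX (i : 'I_k) : exists X : {set T}, X \subset F i /\ #|X| = w.
  by have [s c] := F1 i (ltn_ord i); have [X] := trim c; exists X.
have [X HX] := fin_all_exists exX.
have antiX (i j : 'I_k) : i != j -> anti r (X i) (X j).
  rewrite -val_eqE neq_ltn => /orP[] lt.
    exact: anti_sub (HX i).1 (HX j).1 (F2 _ _ lt (ltn_ord j)).
  by apply: anti_sym rs _; apply: anti_sub (HX j).1 (HX i).1 (F2 _ _ lt (ltn_ord i)).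
set U := \bigcup_(i : 'I_k) X i.
have leU : k * w <= #|U|.
  have := @sum_disj T _ [set: 'I_k] U (fun i x => x \in X i).
  rewrite (eq_bigr (fun=> w)) => [|i _].
    rewrite sum_nat_const cardsT card_ord; apply=> x i j _ _ _ xi xj.
    by apply: contraTeq isT => ne; have [] := antiX i j ne x x xi xj; rewrite eqxx.
  rewrite -(HX i).2; apply: eq_card => x; rewrite inE andb_idl // => xi.
  by apply/bigcupP; exists i.
exists U; split.
- by apply/bigcupsP=> i _; apply: subset_trans (HX i).1 (F1 i (ltn_ord i)).1.
- by apply: leq_trans leU; apply: leq_pmull.
move=> x /bigcupP[i _ xi]; apply: leq_trans leU; rewrite leq_mul2l; apply/orP; right.
rewrite -(HX i).2; apply/subset_leq_card/subsetP=> y /setIdP[/bigcupP[j _ yj] rxy].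
have [->//|ne] := eqVneq i j.
by have [_] := antiX i j ne x y xi yj; rewrite rxy.
Qed.

Hypothesis dichotomy : forall S, (exists S', [/\ S' \subset S, #|S| <= N ^ d * #|S'| & sp e N S' \/ sp h N S']) \/
  (exists k w, [/\ 2 <= k <= N, #|S| <= k ^ d * w & blockade e S k w]).

Lemma anti_families S0 w1 : 0 < w1 ->
  (forall S', S' \subset S0 -> w1 <= N ^ d * #|S'| -> sp e N S' \/ sp h N S' -> False) ->
  forall S, S \subset S0 -> w1 <= #|S| -> exists a b F H,
    [/\ 0 < a, 0 < b, anti_family e S a w1 F, anti_family h S b w1 H & #|S| <= N ^ d * w1 * (a * b) ^ d].
Proof.
move=> w10 no S; have [m] := ubnP #|S|; elim: m S => // m IH S ltm sS w1S.
have [small|big] := leqP #|S| (N ^ d * w1).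
  have [F HF] := anti_family_single e w1S; have [H HH] := anti_family_single h w1S.
  by exists 1, 1, F, H; split=> //; rewrite muln1 exp1n muln1.
case: (dichotomy S) => [[S' [sS' cS' spS']]|[k [w [/andP[k2 kN] cS [F [F1 F2]]]]]].
  by case: (no S' (subset_trans sS' sS) _ spS'); apply: leq_trans cS'.
have w1w : w1 <= w.
  rewrite ltnW // -(ltn_pmul2l (_ : 0 < N ^ d)); last by rewrite expn_gt0; lia.
  apply: leq_trans big _; apply: leq_trans cS _.
  by rewrite leq_mul2r leq_expl ?orbT.
have disj i j x : i < j -> j < k -> x \in F i -> x \in F j -> False.
  by move=> ltij ltj xi xj; case: F2 => /(_ i j ltij ltj x x xi xj)[]; rewrite eqxx.
have ltF i : i < k -> #|F i| < m.
  move=> lti; apply: leq_trans (_ : #|S| <= m); last by rewrite -ltnS.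
  apply: proper_card.
  have [sF _] := F1 i lti.
  have [j ltj ne] : exists2 j, j < k & i != j.
    by case: i lti {sF} => [|i] lti; [exists 1 | exists 0; rewrite //; lia].
  have [sFj wj] := F1 j ltj.
  have /card_gt0P[x xj] : 0 < #|F j| by apply: leq_trans (leq_trans w10 w1w) wj.
  apply/properP; split=> //; exists x; first exact: (subsetP sFj).
  by apply/negP=> xi; move: ne; rewrite neq_ltn => /orP[] lt; apply: (disj _ _ x lt).
have exI i : i < k -> exists q : nat * nat * ((nat -> {set T}) * (nat -> {set T})),
    [/\ 0 < q.1.1, 0 < q.1.2, anti_family e (F i) q.1.1 w1 q.2.1, anti_family h (F i) q.1.2 w1 q.2.2 &
     #|F i| <= N ^ d * w1 * (q.1.1 * q.1.2) ^ d].
  move=> lti; have [sF wF] := F1 i lti.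
  have [||a [b [f [g [a0 b0 Hf Hg le]]]]] := IH (F i) (ltF i lti).
  - exact: subset_trans sF sS.
  - exact: leq_trans w1w wF.
  by exists (a, b, (f, g)).
have [q Hq] := bounded_choice (0, 0, ((fun=> set0), (fun=> set0))) exI.
have k0 : 0 < k by apply: ltn_trans k2.
pose o := Ordinal k0.
have final a b i : i < k -> 0 < a -> (q i).1.1 * (q i).1.2 <= a * b ->
    #|S| <= N ^ d * w1 * (k * a * b) ^ d.
  move=> lti a0 le; have [sF wF] := F1 i lti; have [_ _ _ _ leF] := Hq i lti.
  apply: leq_trans cS _; rewrite -[k * a * b]mulnA expnMn mulnCA leq_mul2l; apply/orP; right.
  apply: leq_trans wF _; apply: leq_trans leF _.
  by rewrite leq_mul2l leq_expl ?orbT.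
case: F2 => antiF.
  have [i _ mini] := arg_minnP (fun i : 'I_k => (q i).1.1) (isT : (fun=> true) o).
  have [j _ maxj] := arg_maxnP (fun i : 'I_k => (q i).1.2) (isT : (fun=> true) o).
  have [sFj _] := F1 j (ltn_ord j).
  have [a0 _ _ _ _] := Hq i (ltn_ord i); have [_ b0 _ fb _] := Hq j (ltn_ord j).
  exists (k * (q i).1.1), (q j).1.2,
    (fun x => (q (x %/ (q i).1.1)).2.1 (x %% (q i).1.1)), (q j).2.2; split=> //.
  - by rewrite muln_gt0 k0.
  - apply: (@anti_family_prod _ _ _ _ _ w F (fun l => (q l).2.1)) => // l ltl.
    have [_ _ fa _ _] := Hq l ltl; apply: anti_family_weak fa => //.
    exact: (mini (Ordinal ltl) isT).
  - exact: anti_family_weak fb.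
  - by apply: (final _ _ i) => //; exact: leq_mul (leqnn _) (maxj i isT).
have [i _ mini] := arg_minnP (fun i : 'I_k => (q i).1.2) (isT : (fun=> true) o).
have [j _ maxj] := arg_maxnP (fun i : 'I_k => (q i).1.1) (isT : (fun=> true) o).
have [sFj _] := F1 j (ltn_ord j).
have [_ b0 _ _ _] := Hq i (ltn_ord i); have [a0 _ fa _ _] := Hq j (ltn_ord j).
exists (q j).1.1, (k * (q i).1.2), (q j).2.1,
  (fun x => (q (x %/ (q i).1.2)).2.2 (x %% (q i).1.2)); split=> //.
- by rewrite muln_gt0 k0.
- exact: anti_family_weak fa.
- apply: (@anti_family_prod _ _ _ _ _ w F (fun l => (q l).2.2)) => // l ltl.
  have [_ _ _ fb _] := Hq l ltl; apply: anti_family_weak fb => //.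
  exact: (mini (Ordinal ltl) isT).
- rewrite [_ * (k * _)]mulnC; apply: (final _ _ i) => //.
  by rewrite mulnC; exact: leq_mul (leqnn _) (maxj i isT).
Qed.

Lemma restricted_of_dichotomy S : exists S', [/\ S' \subset S, #|S| <= N ^ (4 * d + 4) * #|S'| & sp e N S' \/ sp h N S'].
Proof.
apply: NNPP => no.
have Np i : 0 < N ^ i by rewrite expn_gt0; lia.
have NX i j : i <= j -> N ^ i <= N ^ j by move=> le; rewrite leq_pexp2l //; lia.
have [S0|/set0Pn[x xS]] := eqVneq S set0.
  by apply: no; exists set0; rewrite sub0set S0 cards0; split=> //; left; apply: sp_set0.
set w1 := #|S| %/ N ^ (3 * d + 2).
have lew : N ^ (3 * d + 2) * w1 <= #|S| by rewrite mulnC leq_trunc_div.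
have w10 : 0 < w1.
  rewrite divn_gt0 ?Np // leqNgt; apply/negP=> lt; apply: no; exists [set x].
  rewrite sub1set xS cards1 muln1; split=> //; last by left; apply: sp_set1.
  by apply: leq_trans (ltnW lt) _; apply: NX; lia.
have geS : #|S| <= N ^ (3 * d + 3) * w1.
  rewrite (_ : 3 * d + 3 = (3 * d + 2).+1); last by lia.
  have := ltn_ceil #|S| (Np (3 * d + 2)); rewrite -/w1 expnS mulnC.
  have := leq_mul N2 (leqnn (N ^ (3 * d + 2) * w1)).
  have := leq_mul w10 (leqnn (N ^ (3 * d + 2))); lia.
have noS S' : S' \subset S -> w1 <= N ^ d * #|S'| -> sp e N S' \/ sp h N S' -> False.
  move=> sS' le spS'; apply: no; exists S'; split=> //.
  apply: leq_trans geS _; apply: (@leq_trans (N ^ (3 * d + 3) * (N ^ d * #|S'|))).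
    by rewrite leq_mul2l le orbT.
  by rewrite mulnA -expnD leq_mul2r NX ?orbT //; lia.
have [a [b [F [H [a0 b0 fa fb le]]]]] := anti_families w10 noS (subxx S) (leq_trans (leq_pmull _ (Np _)) lew).
have finish r : irreflexive r -> symmetric r -> (exists Z, anti_family r S N w1 Z) ->
    (forall X, sp r N X -> sp e N X \/ sp h N X) -> False.
  move=> ri rs [Z HZ] to; have [X [sX wX spX]] := anti_family_sp (ltnW N2) w10 ri rs HZ.
  by apply: (noS X sX) (to X spX); apply: leq_trans wX _; apply: leq_pmull.
have [Na|aN] := leqP N a.
  by apply: (finish e ei es); [exists F; apply: anti_family_weak fa | left].
have [Nb|bN] := leqP N b.
  by apply: (finish h (h_irr e) (hsym es)); [exists H; apply: anti_family_weak fb | right].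
have ab : (a * b) ^ d <= N ^ (2 * d) by rewrite mulnC expnM leq_expl // -mulnn leq_mul // ltnW.
have : #|S| <= N ^ (3 * d) * w1.
  apply: leq_trans le _; rewrite (_ : 3 * d = d + 2 * d); last by lia.
  by rewrite expnD mulnAC leq_mul2r leq_mul2l ab !orbT.
move=> /(leq_trans lew); rewrite leq_pmul2r // leq_exp2l; lia.
Qed.
End CombineBlockades.

(** * Iterating from a constant density *)

Definition restricted (T : finType) (e : rel T) q (X : {set T}) :=
  sp e q X \/ sp (compl_rel e) q X.

Lemma restricted1 (T : finType) (e : rel T) q (x : T) : irreflexive e -> restricted e q [set x].
Proof. by move=> ei; left; apply: sp_set1. Qed.

Lemma restricted0 (T : finType) (e : rel T) q : restricted e q set0.
Proof. by left; apply: sp_set0. Qed.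

Lemma sparse_step (T : finType) (e : rel T) (G : {set T}) p m C :
  symmetric e -> irreflexive e -> P5_free e -> 64 <= p -> 17 <= m -> 0 < C ->
  sp e (p ^ m) G ->
  (exists G' : {set T}, [/\ G' \subset G, #|G| <= (p ^ m) ^ C * #|G'| & restricted e ((p ^ m) ^ 2) G']) \/
  (exists w, #|G| <= (p ^ m) ^ C * w /\ blockade e G p w).
Proof.
move=> es ei P5 p64 m17 C0 spG.
have p0 : 0 < p by apply: leq_trans p64.
have pX i j : i <= j -> p ^ i <= p ^ j by move=> le; rewrite leq_pexp2l.
have YC i : i <= 17 -> p ^ i <= (p ^ m) ^ C.
  move=> le; rewrite -expnM; apply: pX; apply: leq_trans le (leq_trans m17 _).
  by rewrite leq_pmulr.
have [small|big] := ltnP #|G| (2 * p ^ 16).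
  left; have [->|/set0Pn[x xG]] := eqVneq G set0.
    by exists set0; rewrite sub0set cards0; split=> //; apply: restricted0.
  exists [set x]; rewrite sub1set cards1 muln1; split=> //; last exact: restricted1.
  apply: leq_trans (ltnW small) _; apply: leq_trans (YC 17 _) => //.
  by rewrite [p ^ 17]expnS leq_mul2r (leq_trans _ p64) ?orbT.
right; apply: NNPP => no.
apply: (@gyarfas T e es ei P5 G p) => //; first by apply: leq_trans p64.
  move=> x xG; apply: leq_trans (spG x xG); rewrite leq_mul2r pX ?orbT //; exact: ltnW.
move=> X sX leX; case: (boolP [exists x in X, #|X| <= p ^ 4 * #|cmp e X x|]).
  case/exists_inP=> x xX le; exists (cmp e X x).
  by split=> //; [apply: cmp_sub | apply: cmp_conn | apply: cmp_anti].
rewrite negb_exists_in => /forall_inP nox; case: no.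
have p4 : 0 < p ^ 4 by rewrite expn_gt0 p0.
have bigX : 8 * p <= #|X|.
  have p13 : 0 < p ^ 13 by rewrite expn_gt0 p0.
  rewrite -(leq_pmul2l p13); apply: leq_trans leX; apply: leq_trans big.
  have -> : p ^ 16 = p ^ 13 * (p * p * p) by rewrite !mulnA -!expnSr.
  rewrite [2 * _]mulnCA leq_mul2l; apply/orP; right; nia.
have [||F [F1 F2]] := @group T e X (#|X| %/ p ^ 4).+1 p es isT.
- by move=> x xX; rewrite ltnS leq_divRL // mulnC ltnW // ltnNge; apply: nox.
- have := leq_trunc_div #|X| (p ^ 4); have -> : p ^ 4 = p * (p * p * p) by rewrite !expnS expn0 muln1 !mulnA.
  move: bigX p64; clear; move: (_ %/ _) => c le p64 le2.
  have : 8 * (c * p) <= c * (p * (p * p * p)).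
    rewrite [c * (p * _)]mulnA [X in _ <= X]mulnC leq_mul2r; apply/orP; right; nia.
  by move: le2 le; clear; lia.
exists (#|X| %/ p ^ 4).+1; split.
  apply: leq_trans leX _; apply: (@leq_trans (p ^ 13 * (p ^ 4 * (#|X| %/ p ^ 4).+1))).
    by rewrite leq_mul2l [p ^ 4 * _]mulnC ltnW ?orbT // ltn_ceil.
  by rewrite mulnA -expnD leq_mul2r YC ?orbT.
exists F; split; last by left.
by move=> i lti; have [s c] := F1 i lti; split=> //; apply: subset_trans sX.
Qed.

Definition linear_rodl := forall q, exists D, forall (T : finType) (e : rel T),
  symmetric e -> irreflexive e -> P5_free e ->
  forall S : {set T}, exists X : {set T}, [/\ X \subset S, #|S| <= D * #|X| & restricted e q X].

Lemma square_density : linear_rodl -> exists m C, 0 < m /\ forall (T : finType) (e : rel T),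
  symmetric e -> irreflexive e -> P5_free e -> forall p, 64 <= p -> forall G : {set T},
  restricted e (p ^ m) G ->
  (exists G' : {set T}, [/\ G' \subset G, #|G| <= (p ^ m) ^ C * #|G'| & restricted e ((p ^ m) ^ 2) G']) \/
  (exists w, #|G| <= (p ^ m) ^ C * w /\ blockade e G p w).
Proof.
move=> rodl.
have [t0 t0l t0r] : exists2 t0, 64 <= t0 & t0 <= 64 by exists 64.
have [D0 HD] := rodl (t0 ^ 16).
pose c1 := 21 + D0; pose c3 := c1 + 21; pose g := 16 * c3; pose C := 4 * c3 + 5; pose m := 2 * g + 17.
exists m, C; split=> [|T e es ei P5 p p64 G [spG|spG]]; first by rewrite /m addnS.
  by apply: sparse_step => //; rewrite /m leq_addl.
have p0 : 0 < p by apply: leq_trans p64.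
have pX i j : i <= j -> p ^ i <= p ^ j by move=> le; rewrite leq_pexp2l.
apply: NNPP => no.
have m17 : 17 <= m by rewrite leq_addl.
have mg : (2 * g).+1 <= m by rewrite /m addnS ltnS leq_addr.
have p2 : 32 * p <= p ^ 2 by rewrite -mulnn leq_mul2r (leq_trans _ p64) ?orbT.
have c1D : 21 + D0 = c1 by [].
have gE : g = 16 * c3 by []. have CE : C = 4 * c3 + 5 by []. have c3E : c3 = c1 + 21 by [].
move: c1D gE CE c3E m17 mg no spG; clearbody m C g c3 c1 => c1D gE CE c3E m17 mg no spG.
apply: (@no_stuck_sparse_set T e es ei P5 t0 c1 c3 g C D0 p (p ^ m) G) => //.
- by rewrite -c1D leq_addr.
- apply: (@leq_trans (p ^ (2 * g).+1)); last exact: pX.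
  rewrite expnS; apply: leq_mul; first by apply: leq_trans p64.
  by rewrite expnM leq_expl // -mulnn leq_mul2r (leq_trans _ p64) ?orbT.
- by apply: leq_trans p2 _; apply: pX; apply: leq_trans m17.
- move=> t lt.
  have lt8 : t ^ 8 < p ^ m by move: lt; rewrite (_ : t ^ 16 = (t ^ 8) ^ 2) ?ltn_exp2r // -expnM.
  apply: (@leq_trans (p ^ 2 * t)).
    by rewrite leq_mul2r; apply/orP; right; apply: leq_trans p2; rewrite leq_mul2r orbT.
  rewrite -(@leq_exp2r _ _ 8) // expnMn -expnM.
  apply: (@leq_trans (p ^ m * p ^ m)).
    by apply: leq_mul (ltnW lt8); apply: pX; apply: ltnW.
  rewrite (_ : (p ^ m) ^ 8 = p ^ m * p ^ m * (p ^ m) ^ 6); last by rewrite mulnn -expnD.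
  by rewrite leq_pmulr // !expn_gt0 p0.
- apply: (@leq_ltn_trans (p ^ 16)); first by apply: leq_expl; apply: leq_trans t0r p64.
  rewrite -expnM ltn_exp2l //; last by apply: leq_trans p64.
  by apply: leq_trans m17 _; rewrite leq_pmulr.
- apply: leq_trans (ltnW (ltn_expl D0 (isT : 1 < 2))) _.
  apply: (@leq_trans (t0 ^ D0)); first by apply: leq_expl; apply: leq_trans t0l.
  rewrite leq_pexp2l //; [by apply: leq_trans t0l | by rewrite -c1D; lia].
- exact: HD.
- by move=> A sA spA le; apply: no; left; exists A; split=> //; right.
- by move=> w le bl; apply: no; right; exists w.
Qed.

Lemma restricted_weak (T : finType) (e : rel T) q q' (X : {set T}) :
  q' <= q -> restricted e q X -> restricted e q' X.
Proof. by move=> le [] H; [left|right]; apply: sp_weak le H. Qed.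

Lemma blockade_sub (T : finType) (e : rel T) (X S : {set T}) k w :
  X \subset S -> blockade e X k w -> blockade e S k w.
Proof.
move=> sX [F [F1 F2]]; exists F; split=> // i lti.
by have [s c] := F1 i lti; split=> //; apply: subset_trans sX.
Qed.

Lemma restricted_or_blockade : linear_rodl -> exists d, forall (T : finType) (e : rel T),
  symmetric e -> irreflexive e -> P5_free e -> forall N, 2 <= N -> forall S : {set T},
  (exists S' : {set T}, [/\ S' \subset S, #|S| <= N ^ d * #|S'| & restricted e N S']) \/
  (exists k w, [/\ 2 <= k <= N, #|S| <= k ^ d * w & blockade e S k w]).
Proof.
move=> rodl; have [m [C [m0 Hstep]]] := square_density rodl.
have [p0 p064] : exists p0, 64 <= p0 by exists 64.
have [D HD] := rodl (p0 ^ m); pose d := D + 2 * m * C.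
exists d => T e es ei P5 N N2 S.
have D_le b : 2 <= b -> D <= b ^ D.
  by move=> b2; apply: leq_trans (ltnW (ltn_expl D (isT : 1 < 2))) (leq_expl _ b2).
have [X [sX cX rX]] := HD T e es ei P5 S.
have [le|lt] := leqP N (p0 ^ m).
  left; exists X; split=> //; last exact: restricted_weak rX.
  apply: leq_trans cX _; rewrite leq_mul2r; apply/orP; right.
  by apply: leq_trans (D_le N N2) _; rewrite leq_pexp2l ?leq_addr // ltnW.
have cX' : #|S| <= D * (p0 ^ m) ^ C * #|X|.
  apply: leq_trans cX _; rewrite leq_mul2r leq_pmulr ?orbT // !expn_gt0.
  by rewrite (leq_trans _ p064).
have [s] : exists s, N <= p0 ^ m + s by exists N; apply: leq_addl.
elim: s p0 p064 X sX rX lt cX' {HD cX} => [|s IH] p p64 X sX rX lt cX les.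
  by move: les; rewrite addn0 leqNgt lt.
have p2 : 2 <= p by apply: leq_trans p64.
have pp : p <= p ^ m by rewrite -[X in X <= _]expn1 leq_pexp2l // ltnW.
have pC : ((p ^ 2) ^ m) ^ C = (p ^ m) ^ C * (p ^ m) ^ C.
  by rewrite mulnn -!expnM; congr (p ^ _); lia.
have [[X' [sX' cX' rX']]|[w [cw bl]]] := Hstep T e es ei P5 p p64 X rX.
  have {}cX' : #|S| <= D * ((p ^ 2) ^ m) ^ C * #|X'|.
    by apply: leq_trans cX _; rewrite pC mulnA -[in X in _ <= X]mulnA leq_mul2l cX' orbT.
  have {}sX' := subset_trans sX' sX.
  have pm2 : (p ^ m) ^ 2 = (p ^ 2) ^ m by rewrite -!expnM mulnC.
  rewrite pm2 in rX'.
  have [lt2|le2] := ltnP ((p ^ 2) ^ m) N.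
    apply: (IH (p ^ 2) _ X') => //.
      by apply: leq_trans p64 _; rewrite -mulnn leq_pmulr // ltnW.
    apply: leq_trans les _; rewrite -addSnnS leq_add2r -pm2 -mulnn.
    by rewrite ltn_Pmulr ?(leq_trans _ pp) ?(leq_trans p2 pp) //; exact: ltnW.
  left; exists X'; split=> //; last exact: restricted_weak rX'.
  apply: leq_trans cX' _; rewrite leq_mul2r; apply/orP; right.
  rewrite pC /d expnD leq_mul ?D_le //.
  apply: (@leq_trans (N ^ C * N ^ C)); first by apply: leq_mul; apply: leq_expl; apply: ltnW.
  rewrite -expnD leq_pexp2l ?(ltnW N2) // addnn -mul2n mulnAC leq_pmulr //.
right; exists p, w; split; last exact: blockade_sub bl.
  by rewrite p2 (leq_trans pp) // ltnW.
apply: leq_trans cX _; apply: (@leq_trans (D * (p ^ m) ^ C * ((p ^ m) ^ C * w))).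
  by rewrite leq_mul2l cw orbT.
rewrite mulnA leq_mul2r -mulnA -pC /d expnD leq_mul ?orbT ?D_le //.
by rewrite -!expnM mulnA.
Qed.

Lemma polynomial_rodl_nat : linear_rodl -> exists d, forall (T : finType) (e : rel T),
  symmetric e -> irreflexive e -> P5_free e -> forall N, 2 <= N -> forall S : {set T},
  exists S' : {set T}, [/\ S' \subset S, #|S| <= N ^ d * #|S'| & restricted e N S'].
Proof.
move=> rodl; have [d Hd] := restricted_or_blockade rodl.
exists (4 * d + 4) => T e es ei P5 N N2 S.
exact: restricted_of_dichotomy (Hd T e es ei P5 N N2) S.
Qed.

(** * Linear-size restricted sets for constant density *)

Definition rel_of (T : finType) (e : rel T) (b : bool) := if b then e else compl_rel e.

Definition scattered (T : finType) (r : rel T) q (A B : {set T}) :=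
  forall a, a \in A -> q * #|nb r a B| <= #|B|.

Lemma embed k : forall (s : nat -> nat -> bool) q c, exists c', forall (T : finType) (x0 : T)
  (e : rel T) (S : {set T}) n (V : nat -> {set T}), 0 < n ->
  (forall j, j < k -> V j \subset S /\ n <= c * #|V j|) ->
  (exists f : nat -> T, (forall j, j < k -> f j \in V j) /\
     forall i j, i < j -> j < k -> rel_of e (s i j) (f i) (f j)) \/
  (exists b (A B : {set T}), [/\ A \subset S, B \subset S, n <= c' * #|A|, n <= c' * #|B| &
     scattered (rel_of e b) q A B]).
Proof.
elim: k => [|k IH] s q c.
  by exists 0 => T x0 e S n V n0 HV; left; exists (fun=> x0); split.
have [c1 H1] := IH (fun i j => s i.+1 j.+1) q (c * q).
exists (c1 + c * k.+1) => T x0 e S n V n0 HV.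
pose r j := rel_of e (s 0 j).
case: (classic (exists2 v, v \in V 0 &
    forall j, j < k -> #|V j.+1| <= q * #|nb (r j.+1) v (V j.+1)|)) => [[v vV Hv]|no].
  have [|[f [f1 f2]]|[b [A [B [sA sB cA cB sc]]]]] :=
    H1 T x0 e S n (fun j => nb (r j.+1) v (V j.+1)) n0.
  - move=> j ltj; have [sV cV] := HV j.+1 ltj.
    split; first exact: subset_trans (nb_sub _ _ _) sV.
    by apply: leq_trans cV _; rewrite -mulnA leq_mul2l Hv ?orbT.
  - left; exists (fun j => if j is j'.+1 then f j' else v); split.
      by case=> [|j] // ltj; apply: (subsetP (nb_sub _ _ _)); exact: (f1 j ltj).
    move=> [|i] [|j] // ltij ltj; last exact: f2.
    by have := f1 j ltj; rewrite inE => /andP[].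
  by right; exists b, A, B; split=> //; rewrite mulnDl; apply: leq_trans (leq_addr _ _).
right; have [sV0 cV0] := HV 0 isT.
have V0 : 0 < #|V 0| by rewrite lt0n; apply: contraTneq cV0 => ->; rewrite muln0 -ltnNge.
pose Bad (j : 'I_k) := [set v in V 0 | q * #|nb (r j.+1) v (V j.+1)| <= #|V j.+1|].
have [j cj] : exists j : 'I_k, #|V 0| <= k * #|Bad j|.
  apply: NNPP => nj.
  have lt j : k * #|Bad j| <= #|V 0|.-1.
    by rewrite -ltnS prednK // ltnNge; apply/negP=> le; apply: nj; exists j.
  have := @union_bound T _ [set: 'I_k] Bad (V 0) k #|V 0|.-1.
  rewrite cardsT card_ord => H.
  have {H}: k * #|V 0| <= k * #|V 0|.-1.
    apply: H => [v vV|j _]; last exact: lt.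
    apply: NNPP => nv; apply: no; exists v => // j ltj.
    rewrite leqNgt; apply/negP=> ltn; apply: nv; exists (Ordinal ltj) => //.
    by rewrite inE vV /= ltnW.
  rewrite leq_mul2l => /orP[/eqP k0|]; last by lia.
  have /card_gt0P[v vV] := V0; apply: no; exists v => // j; by rewrite k0.
have [sVj cVj] := HV j.+1 (ltn_ord j).
exists (s 0 j.+1), (Bad j), (V j.+1); split=> //.
- by apply: subset_trans sV0; apply/subsetP=> v /setIdP[].
- apply: leq_trans cV0 _; apply: (@leq_trans (c * (k * #|Bad j|))).
    by rewrite leq_mul2l cj orbT.
  by rewrite mulnA leq_mul2r; apply/orP; right; rewrite mulnS; lia.
- apply: leq_trans cVj _; rewrite leq_mul2r; apply/orP; right; rewrite mulnS; lia.
by move=> a /setIdP[].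
Qed.

Lemma P5_free_pair q : exists c, forall (T : finType) (e : rel T),
  symmetric e -> irreflexive e -> P5_free e -> forall S : {set T}, S != set0 ->
  exists b (A B : {set T}), [/\ A \subset S, B \subset S, #|S| <= c * #|A|, #|S| <= c * #|B| &
     scattered (rel_of e b) q A B].
Proof.
have [c H] := @embed 5 (fun i j => i.+1 == j) q 1.
exists c => T e es ei P5 S /set0Pn[x0 x0S].
have S0 : 0 < #|S| by apply/card_gt0P; exists x0.
case: (H T x0 e S #|S| (fun=> S) S0) => // [j _|[f [_ Hf]]]; first by rewrite mul1n.
case: P5; exists (fun i : 'I_5 => f i).
have lt (i j : 'I_5) : i < j -> f i != f j /\ e (f i) (f j) = (i.+1 == j :> nat).
  move=> ltij; have := Hf i j ltij (ltn_ord j); case: eqP => _ /=.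
    by move=> eij; split=> //; apply: contraTneq eij => ->; rewrite ei.
  by case/andP=> ne /negbTE.
split=> [i j E|i j].
  by apply/eqP; apply: contraT; rewrite -val_eqE neq_ltn => /orP[] /lt[]; rewrite E eqxx.
have [ltij|ltji|/val_inj ->] := ltngtP i j.
- have [_ ->] := lt _ _ ltij; rewrite [j.+1 == i]gtn_eqF ?orbF //; lia.
- have [_] := lt _ _ ltji; rewrite es => ->; rewrite [i.+1 == j]gtn_eqF //; lia.
- by rewrite ei orbb; apply/esym/negbTE; rewrite neq_ltn ltnSn orbT.
Qed.

Lemma light_trim (T : finType) (f : T -> nat) (X : {set T}) u : u <= #|X| ->
  exists X' : {set T}, [/\ X' \subset X, #|X'| = u & #|X| * \sum_(x in X') f x <= u * \sum_(x in X) f x].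
Proof.
move=> /subnKC; move: (_ - _) => m; elim: m X => [|m IH] X E.
  by exists X; rewrite -E addn0.
have /card_gt0P[x1 x1X] : 0 < #|X| by lia.
have [x xX maxx] := arg_maxnP f x1X; have {}xX : x \in X by [].
have cX : #|X :\ x| = u + m by have := cardsD1 x X; rewrite xX; lia.
have [X' [sX' cX' le]] := IH (X :\ x) (esym cX).
exists X'; split=> //; first by apply: subset_trans sX' (subD1set _ _).
have sumX : \sum_(y in X) f y = f x + \sum_(y in X :\ x) f y by rewrite (big_setD1 x).
have avg : \sum_(y in X) f y <= #|X| * f x.
  by rewrite -sum_nat_const; apply: leq_sum => y /maxx.
have [X10|X10] := posnP #|X :\ x|.
  move: X10; rewrite cX => X10; have X'0 : X' = set0 by apply/eqP; rewrite -cards_eq0; lia.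
  by rewrite X'0 big_set0 muln0.
move: X10 le avg; rewrite sumX -E cX.
move: (\sum_(y in X') f y) (\sum_(y in X :\ x) f y) (f x) => a b c; clear.
move=> p le1 le2; rewrite -(leq_pmul2l p).
have := leq_mul (leqnn (u + m.+1)) le1; have := leq_mul (leqnn u) le2; lia.
Qed.

Definition light (T : finType) (r : rel T) q w (A B : {set T}) :=
  [/\ forall a b, a \in A -> b \in B -> a != b,
      forall a, a \in A -> q * #|nb r a B| <= w &
      forall b, b \in B -> q * #|nb r b A| <= w].

Lemma many_good (T : finType) (r : rel T) q u (A B : {set T}) : #|A| = 2 * u ->
  4 * q * \sum_(a in A) #|nb r a B| <= 4 * (u * u) ->
  exists A' : {set T}, [/\ A' \subset A, #|A'| = u & forall a, a \in A' -> q * #|nb r a B| <= u].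
Proof.
move=> cA le; have [->|u0] := posnP u.
  by exists set0; rewrite sub0set cards0; split=> // a; rewrite inE.
pose Bad := [set a in A | u < q * #|nb r a B|].
have sBad : Bad \subset A by apply/subsetP=> a /setIdP[].
have leBad : #|Bad| * u <= q * \sum_(a in A) #|nb r a B|.
  rewrite big_distrr -sum_nat_const /= [X in _ <= X](big_setID Bad) /= (setIidPr sBad).
  apply: leq_trans (leq_addr _ _); apply: leq_sum => a; by rewrite inE => /andP[_ /ltnW].
have [|A' sA' cA'] := @trim T (A :\: Bad) u.
  have := cardsID Bad A; rewrite (setIidPr sBad) cA.
  have : #|Bad| <= u by rewrite -(leq_pmul2r u0); lia.
  lia.
exists A'; split=> //; first exact: subset_trans sA' (subsetDl _ _).
move=> a /(subsetP sA'); rewrite in_setD => /andP[nB aA].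
by rewrite leqNgt; apply: contra nB => lt; rewrite inE aA.
Qed.

Lemma sum_nb (T : finType) (r : rel T) (A B : {set T}) : symmetric r ->
  \sum_(a in A) #|nb r a B| = \sum_(b in B) #|nb r b A|.
Proof.
move=> rs; rewrite sum_card_exchange; apply: eq_bigr => b _.
by apply: eq_card => a; rewrite !inE rs.
Qed.

Lemma rel_of_sym (T : finType) (e : rel T) b : symmetric e -> symmetric (rel_of e b).
Proof. by move=> es; case: b => //; apply: hsym. Qed.

Lemma pair_exact q : exists c, forall (T : finType) (e : rel T),
  symmetric e -> irreflexive e -> P5_free e -> forall (S : {set T}) u, 0 < u -> c * u <= #|S| ->
  exists b (A B : {set T}), [/\ A \subset S, B \subset S, #|A| = u, #|B| = u &
     light (rel_of e b) q u A B].
Proof.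
have [c Hc] := P5_free_pair (8 * q).
exists (4 * c).+1 => T e es ei P5 S u u0 cS.
have S0 : S != set0 by rewrite -card_gt0; apply: leq_trans cS; rewrite muln_gt0.
have [b [A [B [sA sB cA cB sc]]]] := Hc T e es ei P5 S S0.
exists b; set r := rel_of e b in sc *.
have rs : symmetric r by apply: rel_of_sym.
have c0 : 0 < c by rewrite lt0n; apply: contraTneq cA => ->; rewrite mul0n -ltnNge card_gt0.
have big (Z : {set T}) : #|S| <= c * #|Z| -> 4 * u <= #|Z|.
  move=> le; rewrite -(leq_pmul2l c0); apply: leq_trans le; apply: leq_trans cS.
  by rewrite mulSn; lia.
have bA := big A cA; have bB := big B cB.
have [|A1 sA1 cA1] := @trim T A (2 * u); first by lia.
set B1 := B :\: A1.
have bB1 : #|B| <= 2 * #|B1|.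
  have := cardsID A1 B; have := subset_leq_card (subsetIr B A1); rewrite -/B1 cA1; lia.
have [|B2 [sB2 cB2 leB2]] := @light_trim T (fun b => #|nb r b A1|) B1 (2 * u); first by lia.
have E : 4 * q * \sum_(b in B2) #|nb r b A1| <= 4 * (u * u).
  have leA1 : 4 * q * \sum_(a in A1) #|nb r a B1| <= 2 * u * #|B1|.
    rewrite -cA1 -sum_nat_const big_distrr; apply: leq_sum => a aA1 /=.
    have := sc a (subsetP sA1 _ aA1); have := subset_leq_card (nb_mono r a (subsetDl B A1)).
    rewrite -/B1; move: bB1; clear; move: #|nb r a B1| #|nb r a B| => x y le1 le2 le3.
    have := leq_mul (leqnn (8 * q)) le2; lia.
  have B10 : 0 < #|B1| by lia.
  rewrite (sum_nb _ _ rs) in leA1; rewrite -(leq_pmul2l B10).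
  move: leA1 leB2; move: (\sum_(b in B1) _) (\sum_(b in B2) _) => x y; clear => le1 le2.
  have := leq_mul (leqnn (4 * q)) le2; have := leq_mul (leqnn (2 * u)) le1; lia.
have sAB x y : x \in A1 -> y \in B2 -> x != y.
  by move=> xA /(subsetP sB2); rewrite in_setD => /andP[n _]; apply: contraNneq n => <-.
have [B3 [sB3 cB3 HB3]] := many_good cB2 E.
rewrite -(sum_nb _ _ rs) in E.
have [A3 [sA3 cA3 HA3]] := many_good cA1 E.
exists A3, B3; split=> //.
- exact: subset_trans sA3 (subset_trans sA1 sA).
- exact: subset_trans sB3 (subset_trans sB2 (subset_trans (subsetDl _ _) sB)).
split.
- by move=> x y /(subsetP sA3) xA /(subsetP sB3) yB; apply: sAB.
- move=> a /HA3; apply: leq_trans; rewrite leq_mul2l; apply/orP; right.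
  exact/subset_leq_card/nb_mono.
- move=> a /HB3; apply: leq_trans; rewrite leq_mul2l; apply/orP; right.
  exact/subset_leq_card/nb_mono.
Qed.

Definition light_family (T : finType) (r : rel T) q w (S : {set T}) k (F : nat -> {set T}) :=
  (forall i, i < k -> F i \subset S /\ #|F i| = w) /\
  (forall i j, i < j -> j < k -> light r q w (F i) (F j)).

Lemma light_family_sub (T : finType) (r : rel T) q w (S S' : {set T}) k F : S \subset S' ->
  light_family r q w S k F -> light_family r q w S' k F.
Proof.
move=> sS [F1 F2]; split=> // i /F1[s c]; split=> //; exact: subset_trans sS.
Qed.

Lemma light_family_cat (T : finType) (r : rel T) q d w (S A B : {set T}) a b F F' :
  A \subset S -> B \subset S -> 0 < d -> light r (q * d) (d * w) A B ->
  light_family r q w A a F -> light_family r q w B b F' ->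
  light_family r q w S (a + b) (fun i => if i < a then F i else F' (i - a)).
Proof.
move=> sA sB d0 [l1 l2 l3] [F1 F2] [F1' F2']; split=> [i lti|i j ltij ltj].
  case: ltnP => ltia; first by have [s c] := F1 i ltia; split=> //; apply: subset_trans sA.
  have [|s c] := F1' (i - a); first by lia.
  by split=> //; apply: subset_trans sB.
case: (ltnP i a) (ltnP j a) => ltia [] ltja; [exact: F2 | | lia | by apply: F2'; lia].
have [s c] := F1 i ltia; have [|s' c'] := F1' (j - a); first by lia.
have red x (X Y : {set T}) : q * d * #|nb r x Y| <= d * w -> X \subset Y -> q * #|nb r x X| <= w.
  move=> le /(nb_mono r x)/subset_leq_card le2; rewrite -(leq_pmul2l d0).
  by apply: leq_trans le; rewrite mulnA [d * q]mulnC leq_mul2l le2 orbT.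
split.
- by move=> x y /(subsetP s) xA /(subsetP s') yB; apply: l1.
- by move=> x /(subsetP s) xA; apply: red (l2 x xA) s'.
- by move=> x /(subsetP s') xA; apply: red (l3 x xA) s.
Qed.

Lemma product_families q L : exists2 d, 0 < d & forall (T : finType) (e : rel T),
  symmetric e -> irreflexive e -> P5_free e -> forall (S : {set T}) w, 0 < w -> d * w <= #|S| ->
  exists a b F H, [/\ light_family e q w S a F, light_family (compl_rel e) q w S b H & 2 ^ L <= a * b].
Proof.
elim: L => [|L [d d0 IH]].
  exists 1 => // T e es ei P5 S w w0; rewrite mul1n => /trim[X sX cX].
  by exists 1, 1, (fun=> X), (fun=> X); split=> //; split=> // i [].
have [c Hc] := pair_exact (q * d).
exists (c.+1 * d) => [|T e es ei P5 S w w0 cS]; first by rewrite muln_gt0.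
have dw0 : 0 < d * w by rewrite muln_gt0 d0.
have [|b0 [A [B [sA sB cA cB lAB]]]] := Hc T e es ei P5 S (d * w) dw0.
  by apply: leq_trans cS; rewrite mulSn mulnDl mulnA leq_addl.
have [a [b [F [H [HF HH le]]]]] := IH T e es ei P5 A w w0 (eq_leq (esym cA)).
have [a' [b' [F' [H' [HF' HH' le']]]]] := IH T e es ei P5 B w w0 (eq_leq (esym cB)).
have sum2 x y z t : 2 ^ L <= x * z -> 2 ^ L <= y * t -> z <= t -> 2 ^ L.+1 <= (x + y) * t.
  move=> h1 h2 h3; rewrite expnS mul2n -addnn mulnDl leq_add //.
  by apply: leq_trans h1 _; rewrite leq_mul2l h3 orbT.
case: b0 lAB => lAB.
  have lF := light_family_cat sA sB d0 lAB HF HF'.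
  case: (leqP b b') => [bb|/ltnW bb].
    exists (a + a'), b', (fun i => if i < a then F i else F' (i - a)), H'; split=> //.
      exact: light_family_sub HH'.
    exact: sum2 le le' bb.
  exists (a + a'), b, (fun i => if i < a then F i else F' (i - a)), H; split=> //.
    exact: light_family_sub HH.
  by rewrite addnC; apply: sum2 le' le bb.
have lF := light_family_cat sA sB d0 lAB HH HH'.
rewrite mulnC in le; rewrite mulnC in le'.
case: (leqP a a') => [aa|/ltnW aa].
  exists a', (b + b'), F', (fun i => if i < b then H i else H' (i - b)); split=> //.
    exact: light_family_sub HF'.
  by rewrite mulnC; apply: sum2 le le' aa.
exists a, (b + b'), F, (fun i => if i < b then H i else H' (i - b)); split=> //.
  exact: light_family_sub HF.
by rewrite mulnC addnC; apply: sum2 le' le aa.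
Qed.

Lemma light_family_sp (T : finType) (r : rel T) q w (S : {set T}) k F : symmetric r ->
  2 * q <= k -> 0 < q -> 0 < w -> light_family r (2 * q) w S k F ->
  exists U : {set T}, [/\ U \subset S, w <= #|U| & sp r q U].
Proof.
move=> rs lek q0 w0 [F1 F2]; set m := 2 * q in lek F1 F2.
have cF (i : 'I_m) : #|F i| = w by have [] := F1 i (leq_trans (ltn_ord i) lek).
have lt (i j : 'I_m) : i != j -> light r m w (F i) (F j).
  rewrite -val_eqE neq_ltn => /orP[] ltij; first exact: F2 (leq_trans (ltn_ord j) lek).
  have [l1 l2 l3] := F2 j i ltij (leq_trans (ltn_ord i) lek).
  by split=> // a b aF bF; rewrite eq_sym; apply: l1.
set U := \bigcup_(i : 'I_m) F i.
have leU : m * w <= #|U|.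
  have := @sum_disj T _ [set: 'I_m] U (fun i x => x \in F i).
  rewrite (eq_bigr (fun=> w)) => [|i _].
    rewrite sum_nat_const cardsT card_ord; apply=> x i j _ _ _ xi xj.
    by apply: contraTeq isT => ne; have [l1 _ _] := lt i j ne; have := l1 x x xi xj; rewrite eqxx.
  rewrite -(cF i); apply: eq_card => x; rewrite inE andb_idl // => xi.
  by apply/bigcupP; exists i.
have m0 : 0 < m by rewrite /m; lia.
exists U; split.
- by apply/bigcupsP=> i _; have [] := F1 i (leq_trans (ltn_ord i) lek).
- by apply: leq_trans leU; apply: leq_pmull.
move=> x /bigcupP[i _ xi]; apply: leq_trans leU.
have few : m * #|nb r x U :\: F i| <= #|[set~ i]| * w.
  apply: (@union_bound T _ [set~ i] (fun j => nb r x (F j))).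
    move=> y; rewrite in_setD => /andP[nyi /setIdP[/bigcupP[j _ yj] rxy]]; exists j.
      by rewrite !inE; apply: contraNneq nyi => <-.
    by apply/setIdP.
  by move=> j; rewrite !inE eq_sym => ne; have [_ l2 _] := lt i j ne; apply: l2.
have le1 : #|[set~ i]| <= m by rewrite -[X in _ <= X]card_ord max_card.
have {}few : #|nb r x U :\: F i| <= w.
  rewrite -(leq_pmul2l m0); apply: leq_trans few _; by rewrite leq_mul2r le1 orbT.
have := cardsID (F i) (nb r x U); have := subset_leq_card (subsetIr (nb r x U) (F i)).
rewrite cF => le2 le3.
have : #|nb r x U| <= 2 * w by lia.
by move=> le4; rewrite /m [2 * q]mulnC -mulnA leq_mul2l le4 orbT.
Qed.

Lemma linear_rodl_holds : linear_rodl.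
Proof.
move=> q'; set q := q'.+1; have [d d0 Hd] := product_families (2 * q) (2 * (2 * q)).
exists (2 * d) => T e es ei P5 S.
have [->|/set0Pn[x xS]] := eqVneq S set0.
  by exists set0; rewrite sub0set cards0; split=> //; apply: restricted0.
have [small|big] := ltnP #|S| d.
  exists [set x]; rewrite sub1set cards1 muln1; split=> //; last exact: restricted1.
  by lia.
set w := #|S| %/ d.
have w0 : 0 < w by rewrite divn_gt0.
have lew : d * w <= #|S| by rewrite mulnC leq_trunc_div.
have [a [b [F [H [HF HH le]]]]] := Hd T e es ei P5 S w w0 lew.
have geS : #|S| <= 2 * d * w.
  have := ltn_ceil #|S| d0; rewrite -/w; have := leq_mul (leqnn d) w0; lia.
have fin r : symmetric r -> (exists k F', 2 * q <= k /\ light_family r (2 * q) w S k F') ->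
    exists U : {set T}, [/\ U \subset S, #|S| <= 2 * d * #|U| & sp r q' U].
  move=> rs [k [F' [lek HF']]]; have [U [sU wU spU]] := light_family_sp rs lek isT w0 HF'.
  exists U; split=> //; last exact: sp_weak (leqnSn _) spU.
  by apply: leq_trans geS _; rewrite leq_mul2l wU orbT.
have [qa|aq] := leqP (2 * q) a.
  by have [|U [sU cU spU]] := fin e es; [exists a, F | exists U; split=> //; left].
have [qb|bq] := leqP (2 * q) b.
  by have [|U [sU cU spU]] := fin _ (hsym es); [exists b, H | exists U; split=> //; right].
have : a * b < 2 ^ (2 * (2 * q)).
  rewrite mul2n -addnn expnD; apply: (@leq_ltn_trans (2 * q * (2 * q))).
    by apply: leq_mul; apply: ltnW.
  by apply: ltn_mul; apply: ltn_expl.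
by rewrite ltnNge le.
Qed.

(** * Real parameters *)

Lemma INR_muln m n : INR (m * n) = (INR m * INR n)%R.
Proof. exact: mult_INR. Qed.

Lemma INR_expn m n : INR (m ^ n) = (INR m ^ n)%R.
Proof. by elim: n => [|n IH]; rewrite ?expnS ?INR_muln ?IH. Qed.

Lemma INR_leq m n : m <= n -> (INR m <= INR n)%R.
Proof. by move/leP; apply: le_INR. Qed.

Lemma sp_sparse_on (T : finType) (r : rel T) N eps (S : {set T}) :
  (0 < eps)%R -> (1 <= eps * INR N)%R -> sp r N S -> sparse_on r S eps.
Proof.
move=> e0 eN spS v vS; have /INR_leq := spS v vS; rewrite INR_muln /nb.
move: (pos_INR #|[set u in S | r v u]|); move: (INR #|[set _ in _ | _]|) (INR #|S|) (INR N) eN.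
move=> x y z eN x0 le.
have := Rmult_le_compat_l _ _ _ (Rlt_le _ _ e0) le; nra.
Qed.

Lemma inverse_nat eps : (0 < eps < 1/2)%R ->
  exists2 N, 2 <= N & (1 <= eps * INR N)%R /\ (eps * eps * INR N <= 1)%R.
Proof.
move=> [e0 e2]; have [u1 u2] := archimed (/ eps).
have i0 : (2 < / eps)%R.
  have : (eps * / eps = 1)%R by apply: Rinv_r; lra.
  nra.
have E : (eps * / eps = 1)%R by apply: Rinv_r; lra.
have [N EN] : exists N, up (/ eps) = Z.of_nat N by apply: IZN; apply: le_IZR; lra.
exists N; rewrite EN -INR_IZR_INZ in u1 u2.
  by apply/leP; apply: INR_le; rewrite /=; lra.
move: (INR N) (/ eps)%R u1 u2 i0 E => x y u1 u2 i0 E.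
split; first nra.
have h1 : (eps * (x - y) <= eps)%R by nra.
nra.
Qed.

Theorem theorem1p5 :
  exists d : R, (0 < d)%R /\
    forall eps : R, (0 < eps < 1/2)%R ->
    forall (T : finType) (e : rel T), simple_graph e -> P5_free e ->
    exists S : {set T}, restricted_on e S eps /\
      (Rpower eps d * INR #|T| <= INR #|S|)%R.
Proof.
have [d Hd] := polynomial_rodl_nat linear_rodl_holds.
exists (INR (2 * d).+1); split; first by apply: lt_0_INR; apply/leP.
move=> eps heps T e [es ei] P5.
have [N N2 [N3 N4]] := inverse_nat heps.
have [e0 e1] := heps.
have [S [_ cS rS]] := Hd T e es ei P5 N N2 [set: T].
exists S; split; first by case: rS => spS; [left|right]; apply: sp_sparse_on spS.
move/INR_leq: cS; rewrite cardsT INR_muln INR_expn => cS.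
rewrite Rpower_pow // mul2n -addnn -tech_pow_Rmult Rdef_pow_add -Rpow_mult_distr.
have p1 : (0 <= (eps * eps * INR N) ^ d <= 1)%R.
  have le0 : (0 <= eps * eps * INR N)%R by have := pos_INR N; nra.
  split; first exact: pow_le.
  by rewrite -(pow1 d); apply: pow_incr.
rewrite Rpow_mult_distr in p1.
have q0 : (0 <= (eps * eps) ^ d)%R by apply: pow_le; nra.
have S0 := pos_INR #|S|.
have h1 := Rmult_le_compat_l _ _ _ q0 cS.
have h2 : ((eps * eps) ^ d * (INR N ^ d * INR #|S|) <= INR #|S|)%R.
  by rewrite -Rmult_assoc; nra.
have T0 := pos_INR #|T|; nra.
Qed.
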